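(* Let $T$ be a tree of diameter $d$ and radius $r$, and for each integer $i$ with $r \leq i \leq d$ let $m_i$ be the number of vertices of $T$ of eccentricity $i$. Then $$D(T) \leq \max\Bigl\{ m_d - 1, \ \max_{r \leq i < d} (m_i - 2) \Bigr\},$$ unless $T \in \mathcal{D}$, and $$F(T) \leq m_d - 2 + \sum_{i=r}^{d-1} \max\{ m_i - 3, 0\},$$ unless $T \in \mathcal{F}$, where $\mathcal{D}$ and $\mathcal{F}$ are the families of trees defined in the context.
   Context: Graphs are finite and simple; a tree is a connected graph without cycles. The eccentricity of a vertex $v$ in a connected graph $G$ is $\max_{w \in V(G)} \mathrm{dist}(v,w)$; the radius and diameter of $G$ are the minimum and maximum eccentricity of its vertices. The distinguishing number $D(G)$ is the minimum number of colors in a (not necessarily proper) vertex coloring of $G$ such that the only automorphism of $G$ preserving the color of every vertex is the identity. The fixing number $F(G)$ is the minimum cardinality of a set $S \subseteq V(G)$ such that the only automorphism of $G$ fixing every vertex of $S$ is the identity. For positive integers $k_1, k_2, \ldots, k_t$, the spider $S_{k_1,k_2,\ldots,k_t}$ is the tree of order $1 + k_1 + \cdots + k_t$ obtained from disjoint paths of orders $k_1, \ldots, k_t$ by appending them to a single vertex (joining one end of each path to that vertex by an edge). For a positive integer $k$, the spider $S_{k,1,1,\ldots,1}$ (with one or more entries equal to $1$ following $k$) is called a broom of diameter $k+1$; the end of the broom is the leaf which is part of the path of length $k$. $\mathcal{D}$ is the family of trees consisting (up to isomorphism) of all paths, all stars, and all spiders $S_{r,r,k}$ with $1 \leq k < r$.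 $\mathcal{F}$ is the family of trees consisting (up to isomorphism) of all trees in $\mathcal{D}$ and, in addition, for positive integers $r$, the trees $S_{r,r,1,1,\ldots,1}$ and the trees obtained from a path of length $2r$ and a broom of diameter at most $r$ by identifying the central vertex of the path with the end of the broom. *)

(* Defs.v *)
(* Mathematical Components (ssreflect style). *)
From HB Require Import structures.
From mathcomp Require Import all_boot all_order all_algebra all_fingroup.

Set Implicit Arguments.
Unset Strict Implicit.
Unset Printing Implicit Defensive.

(* A finite graph is given by its adjacency relation on a finType. *)

Section Graphs.
Variables (T : finType) (e : rel T).

Definition simple_graph : Prop := symmetric e /\ irreflexive e.

Definition connected_graph : Prop :=
  0 < #|T| /\ forall x y : T, connect e x y.

(* A ucycle of size 2 is an edge traversed back and forth, so the graph-theoretic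
   cycles are the duplicate-free e-cycles of size at least 3. *)
Definition acyclic_graph : Prop :=
  forall p : seq T, 2 < size p -> ~ ucycle e p.

Definition tree : Prop :=
  [/\ simple_graph, connected_graph & acyclic_graph].

Definition has_walk (x y : T) (n : nat) : bool :=
  [exists p : n.-tuple T, path e x p && (last x p == y)].

(* Shortest walks have length < #|T|; #|T| is a junk value for disconnected
   pairs. *)
Definition dist (x y : T) : nat :=
  \big[minn/#|T|]_(n < #|T| | has_walk x y n) n.

Definition eccentricity (v : T) : nat := \max_(w : T) dist v w.

(* The neutral element #|T| is irrelevant: in a connected graph all
   eccentricities are smaller. *)
Definition radius : nat := \big[minn/#|T|]_(v : T) eccentricity v.

Definition diameter : nat := \max_(v : T) eccentricity v.

Definition ecc_count (i : nat) : nat := #|[set v : T | eccentricity v == i]|.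

Definition automorphism (s : {perm T}) : bool :=
  [forall x, forall y, e (s x) (s y) == e x y].

Definition distinguishing_coloring (k : nat) (c : {ffun T -> 'I_k}) : bool :=
  [forall s : {perm T},
     (automorphism s && [forall x, c (s x) == c x]) ==> (s == 1%g)].

Definition distinguishable (k : nat) : bool :=
  [exists c : {ffun T -> 'I_k}, distinguishing_coloring c].

Lemma distinguishable_ex : exists k, distinguishable k.
Proof.
exists #|T|; apply/existsP; exists [ffun x => enum_rank x].
apply/forallP => s; apply/implyP => /andP[_ /forallP sP].
apply/eqP/permP => x; rewrite perm1; apply: enum_rank_inj.
by have /eqP := sP x; rewrite !ffunE.
Qed.

Definition distinguishing_number : nat := ex_minn distinguishable_ex.

Definition fixing_set (S : {set T}) : bool :=
  [forall s : {perm T},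
     (automorphism s && [forall x in S, s x == x]) ==> (s == 1%g)].

Lemma fixing_ex : exists k, [exists S : {set T}, fixing_set S && (#|S| == k)].
Proof.
exists #|[set: T]|; apply/existsP; exists [set: T]; rewrite eqxx andbT.
apply/forallP => s; apply/implyP => /andP[_ /forall_inP sP].
by apply/eqP/permP => x; rewrite perm1; apply/eqP/sP; rewrite inE.
Qed.

Definition fixing_number : nat := ex_minn fixing_ex.

End Graphs.

Definition graph_iso (T1 T2 : finType) (e1 : rel T1) (e2 : rel T2) : Prop :=
  exists2 f : T1 -> T2, bijective f & forall x y, e2 (f x) (f y) = e1 x y.

(* The path with n vertices. *)
Definition path_graph (n : nat) : rel 'I_n :=
  fun i j => (i.+1 == j :> nat) || (j.+1 == i :> nat).

(* The star K_{1,n}, with centre None. *)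
Definition star_graph (n : nat) : rel (option 'I_n) :=
  fun u v => (u == None) (+) (v == None).

(* The vertices of the spider S_{k_1,...,k_t}, ks = [:: k_1; ...; k_t]: None is
   the centre, Some (i, j) the vertex at distance j + 1 from it on leg i. *)
Definition spider_vertex (ks : seq nat) : finType :=
  option {i : 'I_(size ks) & 'I_(nth 0 ks i)}.

Definition spider_graph (ks : seq nat) : rel (spider_vertex ks) :=
  fun u v =>
    match u, v with
    | None, None => false
    | None, Some y => tagged y == 0 :> nat
    | Some x, None => tagged x == 0 :> nat
    | Some x, Some y =>
        (tag x == tag y) &&
        (((tagged x).+1 == tagged y :> nat) || ((tagged y).+1 == tagged x :> nat))
    end.

(* For k, s > 0 this is a broom, of diameter k + 1. *)
Definition broom_legs (k s : nat) : seq nat := k :: nseq s 1.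

Lemma broom_end_subproof (k : nat) : 0 < k -> k.-1 < k.
Proof. by rewrite ltn_predL. Qed.

Definition broom_end (k s : nat) (k_gt0 : 0 < k) :
    spider_vertex (broom_legs k s) :=
  Some (existT (fun i : 'I_(size (broom_legs k s)) => 'I_(nth 0 (broom_legs k s) i))
          ord0 (Ordinal (broom_end_subproof k_gt0))).

(* Disjoint union of two graphs with x1 and x2 identified; the merged vertex is
   inl x1. *)
Definition glue_graph (T1 T2 : finType) (e1 : rel T1) (e2 : rel T2)
    (x1 : T1) (x2 : T2) : rel (T1 + {y : T2 | y != x2}) :=
  fun u v =>
    match u, v with
    | inl a, inl b => e1 a b
    | inr a, inr b => e2 (val a) (val b)
    | inl a, inr b => (a == x1) && e2 x2 (val b)
    | inr a, inl b => (b == x1) && e2 (val a) x2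
    end.

Arguments path_graph n : clear implicits.
Arguments star_graph n : clear implicits.
Arguments spider_graph ks : clear implicits.
Arguments glue_graph {T1 T2} e1 e2 x1 x2.

Inductive family_D (T : finType) (e : rel T) : Prop :=
  | family_D_path (n : nat) of 0 < n & graph_iso e (path_graph n)
  | family_D_star (n : nat) of 0 < n & graph_iso e (star_graph n)
  | family_D_spider (r k : nat) of 0 < k & k < r
      & graph_iso e (spider_graph [:: r; r; k]).

(* In family_F_broom, a path of length 2r has 2r + 1 vertices and centre r. *)
Inductive family_F (T : finType) (e : rel T) : Prop :=
  | family_F_D of family_D e
  | family_F_spider (r s : nat) of 0 < r & 0 < s
      & graph_iso e (spider_graph [:: r, r & nseq s 1])
  | family_F_broom (r k s : nat) (k_gt0 : 0 < k) of 0 < r & 0 < s & k + 1 <= r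
      & graph_iso e
          (glue_graph (path_graph (2 * r).+1) (spider_graph (broom_legs k s))
             (inord r) (broom_end s k_gt0)).

(* Main.v *)
Require Import Defs.
From HB Require Import structures.
From mathcomp Require Import all_boot all_order all_algebra all_fingroup.
From mathcomp Require Import zify.
Set Implicit Arguments.
Unset Strict Implicit.
Unset Printing Implicit Defensive.

(** Let [h] be the eccentricity. Two distinct neighbours of [v] lie in different
    components of the tree minus [v], so a vertex farthest from [v] lies beyond
    at most one of them, and all neighbours of [v] but at most one have height
    [h v + 1] ([tree_lower_unique]). The exceptional neighbour is the parent of
    [v]; it is lower than [v] unless [v] is a centre. The tree is thus rooted at
    its one or two centres, the vertices of eccentricity [i] form one level, and
    automorphisms preserve heights and parents. Moreover, if there is more than
    one vertex, then the deepest vertices do not all lie in the same branch at the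
    centre ([tree_rooting]).

    Both bounds follow from one construction. Suppose that a set [O] contains two
    of the deepest vertices, and three vertices of each other level (or the whole
    level, if it is smaller), and that only the identity fixes all vertices
    outside [O]; in the code, [O] is [large] and [rigid]. Then the complement of
    [O] is a fixing set of the required size ([large_complement]), and colouring
    [O] with one colour and the rest of each level with distinct other colours
    uses as few colours as required ([rigid_colourable]).

    To find [O], let the spine be the set of all ancestors of deepest vertices. It
    has at least two vertices in each level except that of a single centre. If
    [O] contains two of them and one more vertex in each level, then a symmetry
    that moves only vertices of [O] is trivial as soon as it fixes the deepest
    vertices, because no permutation moves just one vertex of a level. So all that
    is needed is an obstruction to exchanging the two deepest vertices left free.
    There is one if two deepest vertices lie in the same branch, or if there are
    three branches with deepest vertices and another level with at least four
    vertices, one of which can be kept fixed ([rigid_of_asymmetric_triple]). Three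
    such branches and no such level leave only stars and spiders with three equal
    legs ([three_deep]). If there are just two deepest vertices, then the spine
    consists of two legs, and their exchange is obstructed by a vertex attached to
    one of them, or by keeping a vertex of one leg fixed in a level with two other
    vertices that are not leaves with the same parent ([rigid_of_attached],
    [rigid_of_pair]). What remains is identified
    with the members of the families ([two_legs]). The members of the second
    family that are not in the first still satisfy the bound on colours, by the
    explicit colourings [three_legs_colourable] and [colourable_of_pair]. *)

(** * Distances as lengths of shortest walks *)

Lemma bigminn_le (I : finType) (N : nat) (P : pred I) (F : I -> nat) i :
  P i -> \big[minn/N]_(j | P j) F j <= F i.
Proof.
move=> Pi; have := mem_index_enum i.
elim: (index_enum I) => // j s IHs; rewrite in_cons big_cons.
case/predU1P=> [<-|/IHs le_s]; first by rewrite Pi geq_minl.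
by case: ifP => // _; apply: leq_trans le_s; apply: geq_minr.
Qed.

Lemma bigminn_attained (I : finType) (N : nat) (P : pred I) (F : I -> nat) :
  let v := \big[minn/N]_(j | P j) F j in
  v = N \/ exists2 i, P i & v = F i.
Proof.
move=> v; rewrite /v; elim/big_ind: _ => [|m n Hm Hn|i Pi].
- by left.
- by case: (leqP m n) => _.
- by right; exists i.
Qed.

Section Distance.
Variables (T : finType) (e : rel T).
Implicit Types (x y z : T) (q : seq T).

Lemma has_walkP x y n :
  reflect (exists q, [/\ path e x q, last x q = y & size q = n])
          (has_walk e x y n).
Proof.
apply: (iffP existsP) => [[q /andP[pq /eqP lq]]|[q [pq lq sq]]].
  by exists q; split=> //; rewrite size_tuple.
move/eqP: sq => sq; exists (Tuple sq) => /=.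
by rewrite pq lq eqxx.
Qed.

Lemma dist_le x q : path e x q -> dist e x (last x q) <= size q.
Proof.
move=> pq; case: (ltnP (size q) #|T|) => [lt_q|le_q].
  have wq : has_walk e x (last x q) (size q).
    by apply/has_walkP; exists q.
  exact: (@bigminn_le _ #|T| (fun n : 'I_#|T| => has_walk e x (last x q) n)
                      (fun n : 'I_#|T| => n : nat) (Ordinal lt_q)).
apply: leq_trans le_q; rewrite /dist.
by elim/big_ind: _ => [//|m n le_m _|i _]; [rewrite geq_min le_m | exact: ltnW].
Qed.

(** Repetition-free walks have fewer steps than there are vertices, so between
    connected vertices the default value of [dist] is never reached. *)
Lemma dist_lt x y : connect e x y -> dist e x y < #|T|.
Proof.
case/connectP=> q0 pq0 ->; case/shortenP: pq0 => q pq uq _.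
apply: leq_ltn_trans (dist_le pq) _.
by rewrite -ltnS -[(size q).+1]/(size (x :: q)) -(card_uniqP uq) ltnS max_card.
Qed.

Lemma dist_connected x y : connect e x y ->
  exists q, [/\ path e x q, last x q = y & size q = dist e x y].
Proof.
move/dist_lt; rewrite /dist.
have [->|[n /has_walkP[q [? ? ?]] ->] _] := bigminn_attained #|T|
    (fun n : 'I_#|T| => has_walk e x y n) (fun n : 'I_#|T| => n : nat).
  by rewrite ltnn.
by exists q.
Qed.

Lemma dist_edge x y z : (forall u v, connect e u v) ->
  e x y -> dist e x z <= (dist e y z).+1.
Proof.
move=> con exy; have [q [pq <- <-]] := dist_connected (con y z).
by apply: (@dist_le x (y :: q)); rewrite /= exy.
Qed.

Lemma dist_triangle x y z : (forall u v, connect e u v) ->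
  dist e x z <= dist e x y + dist e y z.
Proof.
move=> con; have [q [pq <- <-]] := dist_connected (con x y).
have [q' [pq' <- <-]] := dist_connected (con (last x q) z).
by rewrite -last_cat -size_cat dist_le // cat_path pq.
Qed.

Lemma dist_sym x y : symmetric e -> (forall u v, connect e u v) ->
  dist e x y = dist e y x.
Proof.
move=> sym con; suff le u v : dist e u v <= dist e v u.
  by apply/eqP; rewrite eqn_leq !le.
have [q [pq <- <-]] := dist_connected (con v u).
have pr : path e (last v q) (rev (belast v q)).
  by rewrite rev_path; under eq_path do rewrite sym.
have := dist_le pr; rewrite size_rev size_belast.
suff -> : last (last v q) (rev (belast v q)) = v by [].
by case: q {pq pr} => //= a q; rewrite rev_cons last_rcons.
Qed.

Lemma dist_ecc x y : dist e x y <= eccentricity e x.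
Proof. by rewrite /eccentricity (bigD1 y) //= leq_maxl. Qed.

Lemma ecc_attained x : exists y, eccentricity e x = dist e x y.
Proof.
case: (@eq_bigmax T (fun y => dist e x y)); last by move=> y; exists y.
by apply/card_gt0P; exists x.
Qed.

End Distance.

(** * Rooting a tree at its centre *)

(** The ancestor of [x] of height [i]. When there are two centres, [p] exchanges
    them instead of lowering their height, which is why [anc] is only used for
    heights [b <= i <= h x], with [b] as in [rooting]. *)
Definition anc (T : Type) (h : T -> nat) (p : T -> T) (i : nat) (x : T) : T :=
  iter (h x - i) p x.

(** What the rest of the proof retains of a tree: the height [h], which is the
    eccentricity, and the parent map [p], which fixes a single centre and
    exchanges two adjacent ones. The height [b] is that of the tops of the
    branches, which are the neighbours of a single centre or else the two
    centres; [d] is the greatest height. *)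
Record rooting (T : finType) (e : rel T) (h : T -> nat) (p : T -> T)
    (b d : nat) : Prop := Rooting {
  rooting_edge : forall x y, e x y = (x != y) && ((p x == y) || (p y == x));
  rooting_parent : forall x, b < h x -> h (p x) = (h x).-1;
  rooting_base :
    (exists c, [/\ p c = c, h c < b, forall x, h x < b -> x = c
                 & forall x, h x = b -> p x = c]) \/
    (exists c c', [/\ c != c', p c = c', p c' = c, forall x, b <= h x
                    & forall x, h x = b -> x = c \/ x = c']);
  rooting_le : forall x, h x <= d;
  rooting_deep : b <= d ->
    exists u v, [/\ h u = d, h v = d & anc h p b u != anc h p b v];
  rooting_aut : forall s : {perm T}, automorphism e s ->
    (forall x, h (s x) = h x) /\ (forall x, p (s x) = s (p x))
}.

Section Tree.
Variables (T : finType) (e : rel T).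
Hypothesis treeT : tree e.
Implicit Types (u v w x y z : T) (q : seq T).
Local Notation ecc := (eccentricity e).

Let sym : symmetric e. Proof. by case: treeT => -[]. Qed.
Let irr : irreflexive e. Proof. by case: treeT => -[]. Qed.
Let con : forall x y, connect e x y. Proof. by case: treeT => _ []. Qed.

Let edge_neq x y : e x y -> x != y.
Proof. by apply: contraTneq => ->; rewrite irr. Qed.

(** The detour and the two edges at [v] would close a cycle. *)
Lemma tree_no_detour v u1 u2 q : e v u1 -> e v u2 -> u1 != u2 ->
  path e u1 q -> last u1 q = u2 -> v \notin u1 :: q -> False.
Proof.
case: treeT => _ _ acyc ev1 ev2 neq pq lq.
move: lq; case/shortenP: pq => q' pq' uq' sub lq vq.
apply: (acyc (v :: u1 :: q')).
  by case: q' lq {pq' uq' sub} => //= E; rewrite E eqxx in neq.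
rewrite /ucycle /= ev1 rcons_path pq' lq sym ev2 /= -/(uniq (u1 :: q')) uq' andbT.
apply: contra vq; rewrite !in_cons => /orP[->//|/sub ->]; exact: orbT.
Qed.

(** Two distinct neighbours of [v] lie in different components of the tree
    minus [v], and [w] belongs to at most one of those. *)
Lemma tree_closer_unique v u1 u2 w : e v u1 -> e v u2 ->
  dist e u1 w <= dist e v w -> dist e u2 w <= dist e v w -> u1 = u2.
Proof.
have avoid u : e v u -> dist e u w <= dist e v w ->
    exists q, [/\ path e u q, last u q = w & v \notin u :: q].
  move=> evu le_d; have [q [pq lq sq]] := dist_connected (con u w).
  exists q; split=> //; rewrite in_cons negb_or edge_neq //=.
  apply/negP => vq; case/splitPr: vq pq lq sq => p1 p2.
  rewrite cat_path last_cat size_cat /= => /and3P[_ _ p2P] lq sq.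
  by have := dist_le p2P; rewrite lq; lia.
move=> ev1 ev2 le1 le2; apply/eqP; apply/negPn/negP => neq.
have [q1 [p1 l1 v1]] := avoid _ ev1 le1.
have [q2 [p2 l2 v2]] := avoid _ ev2 le2.
apply: (@tree_no_detour v u1 u2 (q1 ++ rev (belast u2 q2))) => //.
- rewrite cat_path p1 /= l1 -l2 rev_path.
  by under eq_path do rewrite sym.
- rewrite last_cat l1 -l2; case: (q2) => //= a q.
  by rewrite rev_cons last_rcons.
- rewrite -cat_cons mem_cat negb_or v1 mem_rev.
  by apply: contra v2; apply: mem_belast.
Qed.

Lemma dist_eq0 x y : dist e x y = 0 -> x = y.
Proof. by move=> d0; have [[|a q] [_ // lq]] := dist_connected (con x y); rewrite d0. Qed.

(** A tree is bipartite. If the two distances agreed, then [v] and the first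
    step from [u] towards [w] would contradict [tree_closer_unique] at [u]. *)
Lemma tree_dist_edge_neq u v w : e u v -> dist e u w != dist e v w.
Proof.
move=> euv; apply/eqP => dE.
have [q [pq lq sq]] := dist_connected (con u w).
case: q pq lq sq => [_ /= uw d0|u' q /= /andP[euu' pq] lq sq].
  have := edge_neq euv; rewrite uw (@dist_eq0 v w) ?eqxx //.
  by rewrite -dE -d0.
have := dist_le pq; rewrite lq => le_q.
have E : u' = v by apply: (@tree_closer_unique u _ _ w) => //; lia.
by rewrite E in le_q; lia.
Qed.

(** This is [tree_closer_unique] for a vertex [w] farthest from [v]: beyond all
    neighbours of [v] but one, [w] is farther away than from [v]. *)
Lemma tree_lower_unique v u1 u2 : e v u1 -> e v u2 ->
  ecc u1 <= ecc v -> ecc u2 <= ecc v -> u1 = u2.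
Proof.
move=> e1 e2 l1 l2; have [w wE] := ecc_attained e v.
apply: (@tree_closer_unique v _ _ w) => //; rewrite -wE.
  exact: leq_trans (dist_ecc e u1 w) l1.
exact: leq_trans (dist_ecc e u2 w) l2.
Qed.

Lemma ecc_edge x y : e x y -> ecc x <= (ecc y).+1.
Proof.
move=> exy; have [w ->] := ecc_attained e x.
apply: leq_trans (dist_edge _ con exy) _.
by rewrite ltnS dist_ecc.
Qed.

(** Once a path leaves the only lower neighbour of [x] behind, it never stops
    climbing. *)
Lemma tree_rise y x q : e y x -> ecc y <= ecc x -> path e x q ->
  uniq (y :: x :: q) -> ecc (last x q) = ecc x + size q.
Proof.
elim: q y x => [|z q IHq] y x; first by rewrite addn0.
move=> eyx le_yx /= /andP[exz pq] /and3P[yq xq uq].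
have lt_xz : ecc x < ecc z.
  rewrite ltnNge; apply/negP => le_zx; move: yq.
  rewrite !in_cons -(@tree_lower_unique x y z) ?eqxx ?orbT //.
  by rewrite sym.
have U : uniq (x :: z :: q) by rewrite /= xq.
have -> := IHq x z exz (ltnW lt_xz) pq U.
have := ecc_edge exz; rewrite sym in exz; have := ecc_edge exz; lia.
Qed.

Lemma centre_exists : exists2 c, ecc c = radius e & forall x, radius e <= ecc x.
Proof.
case: treeT => _ [/card_gt0P[x0 _] _] _.
have ge x : radius e <= ecc x by apply: (@bigminn_le _ _ predT).
case: (bigminn_attained #|T| (xpredT : pred T) ecc); rewrite -/(radius e).
  move=> rT; have := ge x0; have [y ->] := ecc_attained e x0.
  by rewrite rT leqNgt dist_lt.
by case=> c _ cE; exists c.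
Qed.

(** The default value [v] is only taken at a unique centre. *)
Definition parent v := odflt v [pick u | e v u && (ecc u <= ecc v)].

Lemma parentE v u : e v u -> ecc u <= ecc v -> parent v = u.
Proof.
rewrite /parent => evu le_u; case: pickP => [u' /andP[eu' le_u']|/(_ u)] /=.
  exact: (@tree_lower_unique v).
by rewrite evu le_u.
Qed.

Lemma parentP v :
  (parent v = v /\ forall u, e v u -> ecc v < ecc u) \/
  (e v (parent v) /\ ecc (parent v) <= ecc v).
Proof.
rewrite /parent; case: pickP => [u /andP[eu le_u]|no]; first by right.
by left; split=> // u evu; have := no u; rewrite evu ltnNge => /negbT.
Qed.

Lemma parent_edge x y : e x y = (x != y) && ((parent x == y) || (parent y == x)).
Proof.
apply/idP/andP => [exy|[neq /orP[]/eqP pE]].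
- split; first exact: edge_neq.
  case/orP: (leq_total (ecc y) (ecc x)) => le.
    by rewrite (parentE exy) ?eqxx.
  by rewrite sym in exy; rewrite (parentE exy) ?eqxx ?orbT.
- by case: (parentP x) => [[px _]|[+ _]]; rewrite ?pE // -pE px eqxx in neq *.
- rewrite sym; case: (parentP y) => [[py _]|[+ _]]; rewrite ?pE //.
  by rewrite -pE py eqxx in neq.
Qed.

(** A path from [v] to a centre must go down at its first step, because by
    [tree_rise] it could not come down later. *)
Lemma ecc_parent v : radius e < ecc v -> ecc (parent v) = (ecc v).-1.
Proof.
move=> rv; have [c cE min_c] := centre_exists.
case/connectP: (con v c) => q0 pq0 lq0.
move: lq0; case/shortenP: pq0 => q pq uq _ lq.
case: q pq uq lq => [_ _ vc|z q]; first by move: rv; rewrite -cE vc ltnn.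
move=> /= /andP[evz pq] uq lq.
have lt_zv : ecc z < ecc v.
  rewrite ltnNge; apply/negP => le_vz.
  have := tree_rise evz le_vz pq uq; rewrite -lq cE; lia.
rewrite (parentE evz (ltnW lt_zv)).
by have := ecc_edge evz; lia.
Qed.

(** A path between two centres that does not reach the second one at once would
    climb by [tree_rise], and end too high. *)
Lemma centres_adjacent c c' : ecc c = radius e -> ecc c' = radius e ->
  c != c' -> e c c'.
Proof.
move=> cE c'E neq; have [_ _ min_c] := centre_exists.
case/connectP: (con c c') => q0 pq0 lq0.
move: lq0; case/shortenP: pq0 => q pq uq _ lq.
case: q pq uq lq => [_ _ E|z q]; first by rewrite E eqxx in neq.
move=> /= /andP[ecz pq] uq lq.
have le : ecc c <= ecc z by rewrite cE.
have := tree_rise ecz le pq uq; rewrite -lq c'E => E.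
case: q pq uq lq E => [_ _ -> //|a q _ _ _ /= E].
by have := min_c z; lia.
Qed.

Lemma dist_iter_parent x n : dist e x (iter n parent x) <= n.
Proof.
elim: n => [|n IHn] /=; first exact: (@dist_le _ e x [::]).
set y := iter n parent x in IHn *.
have step : dist e y (parent y) <= 1.
  case: (parentP y) => [[-> _]|[ey _]].
    exact: leq_trans (@dist_le _ e y [::] _) _.
  by apply: (@dist_le _ e y [:: parent y]); rewrite /= ey.
apply: leq_trans (dist_triangle x y _ con) _; lia.
Qed.

Lemma ecc_le_diameter x : ecc x <= diameter e.
Proof. by rewrite /diameter (bigD1 x) //= leq_maxl. Qed.

Lemma diameter_attained : exists u, ecc u = diameter e.
Proof.
case: (@eq_bigmax T ecc); last by move=> u uE; exists u; rewrite -uE.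
by case: treeT => _ [].
Qed.

(** Both ends of a longest path are deepest vertices. A common ancestor of
    height [b] would bring them within distance [2 * (diameter e - b)]. *)
Lemma diameter_lt_of_common_ancestor x b : diameter e < b.*2 ->
  (forall y, ecc y = diameter e -> anc ecc parent b y = x) -> diameter e < b.
Proof.
move=> lt_d allx; rewrite ltnNge; apply/negP => le_bd.
have [u uE] := diameter_attained; have [w wE] := ecc_attained e u.
have wE' : ecc w = diameter e.
  apply/eqP; rewrite eqn_leq ecc_le_diameter /= -uE wE dist_sym //.
  exact: dist_ecc.
have := dist_triangle u x w con; rewrite -wE uE.
have := dist_iter_parent u (ecc u - b); rewrite -/(anc _ _ b u) allx //.
have := dist_iter_parent w (ecc w - b); rewrite -/(anc _ _ b w) allx //.
rewrite (@dist_sym _ _ w x) // uE wE'; lia.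
Qed.

Lemma automorphism_inv (s : {perm T}) : automorphism e s ->
  automorphism e (s^-1)%g.
Proof.
move/forallP => sP; apply/forallP => x; apply/forallP => y.
have /forallP/(_ ((s^-1)%g y)) := sP ((s^-1)%g x).
by rewrite !permKV eq_sym.
Qed.

Lemma automorphism_ecc (s : {perm T}) x : automorphism e s -> ecc (s x) = ecc x.
Proof.
have dle (t : {perm T}) y z : automorphism e t -> dist e (t y) (t z) <= dist e y z.
  move/forallP => tP; have [q [pq <- <-]] := dist_connected (con y z).
  rewrite -(size_map t) -last_map dist_le // path_map.
  apply: sub_path pq => a a' /=.
  by have /forallP/(_ a')/eqP-> := tP a.
have le (t : {perm T}) y : automorphism e t -> ecc (t y) <= ecc y.
  move=> tP; have [w ->] := ecc_attained e (t y).
  rewrite -[w](permKV t); apply: leq_trans (dle _ _ _ tP) _.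
  exact: dist_ecc.
move=> sP; apply/eqP; rewrite eqn_leq le //=.
by rewrite -{1}[x](permK s) le // automorphism_inv.
Qed.

Lemma automorphism_parent (s : {perm T}) x : automorphism e s ->
  parent (s x) = s (parent x).
Proof.
move=> sP; have eccs y := automorphism_ecc y sP.
have es y z : e (s y) (s z) = e y z.
  by have /forallP/(_ y)/forallP/(_ z)/eqP := sP.
case: (parentP x) => [[-> no]|[ex le]]; last first.
  by apply: parentE; rewrite ?es ?eccs.
case: (parentP (s x)) => [[-> //]|[]].
set y := parent (s x); rewrite -[y](permKV s) es eccs eccs => exy.
by rewrite leqNgt no.
Qed.

(** Two deepest vertices with distinct ancestors of height [b] exist by
    [diameter_lt_of_common_ancestor], once the diameter is known to be less than
    [2 * b]. It is at most twice the radius, which suffices for one centre; for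
    two adjacent centres equality is excluded because the tree is bipartite. *)
Lemma tree_rooting :
  exists b, rooting e ecc parent b (diameter e) /\ radius e <= b.
Proof.
have [c cE min_c] := centre_exists.
have far x : dist e x c <= radius e.
  by rewrite dist_sym // -cE dist_ecc.
have [u0 u0E] := diameter_attained; have [w0 w0E] := ecc_attained e u0.
have d2r : diameter e <= (radius e).*2.
  rewrite -u0E w0E; apply: leq_trans (dist_triangle _ c _ con) _.
  by rewrite -addnn leq_add // dist_sym // far.
pose b := if parent c == c then (radius e).+1 else radius e.
have d2b : diameter e < b.*2.
  rewrite /b; case: eqP => [_|/eqP pc]; first lia.
  case: (parentP c) => [[pcc _]|[ecc' lecc']]; first by rewrite pcc eqxx in pc.
  have far' x : dist e x (parent c) <= radius e.
    have -> : radius e = ecc (parent c) by apply/eqP; rewrite eqn_leq min_c -cE.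
    by rewrite dist_sym // dist_ecc.
  have neqd x : dist e x c != dist e x (parent c).
    by rewrite dist_sym // (dist_sym x) // tree_dist_edge_neq.
  rewrite ltn_neqAle d2r andbT; apply/eqP => dE.
  have := dist_triangle u0 c w0 con.
  have := dist_triangle u0 (parent c) w0 con.
  rewrite (dist_sym c) // (dist_sym (parent c)) // -w0E u0E dE.
  move: (far u0) (far w0) (far' u0) (far' w0) (neqd u0) (neqd w0).
  by move=> ? ? ? ? /eqP ? /eqP ?; lia.
exists b; split; last by rewrite /b; case: ifP.
split.
- exact: parent_edge.
- move=> x bx; apply: ecc_parent; move: bx; rewrite /b; case: ifP => _; lia.
- rewrite /b; case: eqP => [pc|/eqP pc]; [left; exists c|right; exists c, (parent c)].
    have uniq_c x : ecc x = radius e -> x = c.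
      move=> xE; apply/eqP/negPn/negP => neq.
      have exc := centres_adjacent cE xE; rewrite eq_sym in exc.
      have := parentE (exc neq); rewrite xE cE pc leqnn => /(_ isT) E.
      by rewrite E eqxx in neq.
    split=> //; first by rewrite cE.
    + by move=> x lt_x; apply: uniq_c; have := min_c x; lia.
    + by move=> x xE; apply: uniq_c; rewrite ecc_parent xE.
  case: (parentP c) => [[pcc _]|[ecc' lecc']]; first by rewrite pcc eqxx in pc.
  have c'E : ecc (parent c) = radius e by apply/eqP; rewrite eqn_leq min_c -cE lecc'.
  split=> //; first by rewrite eq_sym.
  + by apply: parentE; rewrite 1?sym // c'E cE.
  + move=> x xE; case: (eqVneq x c) => [->|neq]; first by left.
    right; symmetry; apply: parentE; last by rewrite xE cE.
    by apply: centres_adjacent; rewrite // eq_sym.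
- exact: ecc_le_diameter.
- move=> le_bd; have [/existsP[u /existsP[v /and3P[/eqP ? /eqP ? ?]]]|no] :=
    boolP [exists u, exists v, [&& ecc u == diameter e, ecc v == diameter e
             & anc ecc parent b u != anc ecc parent b v]].
    by exists u, v.
  suff: diameter e < b by rewrite ltnNge le_bd.
  apply: (@diameter_lt_of_common_ancestor (anc ecc parent b u0)) => // y yE.
  apply/eqP; apply: contraR no => neq; apply/existsP; exists y.
  by apply/existsP; exists u0; rewrite yE u0E neq !eqxx.
- by move=> s sP; split=> x; [apply: automorphism_ecc|apply: automorphism_parent].
Qed.

End Tree.

(** * Symmetries and rigid sets *)

Section Rooting.
Variables (T : finType) (e : rel T) (h : T -> nat) (p : T -> T) (b d : nat).
Hypothesis R : rooting e h p b d.
Implicit Types (u v w x y z : T) (s : {perm T}) (O : {set T}).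
Local Notation anc := (anc h p).

Definition level i := [set x | h x == i].

Lemma anc_id x : anc (h x) x = x.
Proof. by rewrite /anc subnn. Qed.

Lemma height_anc i x : b <= i <= h x -> h (anc i x) = i.
Proof.
move=> /andP[le_bi le_ix]; rewrite /anc.
suff H n : n <= h x - b -> h (iter n p x) = h x - n by rewrite H; lia.
elim: n => [|n IHn] le_n /=; first by rewrite subn0.
by rewrite (rooting_parent R) IHn; lia.
Qed.

Lemma anc_anc i j x : b <= i <= j -> j <= h x -> anc i (anc j x) = anc i x.
Proof.
move=> /andP[bi ij] jx; rewrite {1}/anc height_anc; last by lia.
by rewrite /anc -iterD; congr (iter _ p x); lia.
Qed.

Lemma anc_parent i x : b <= i < h x -> anc i (p x) = anc i x.
Proof.
move=> /andP[bi ix]; rewrite /anc (rooting_parent R); last by lia.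
by rewrite -iterSr; congr (iter _ p x); lia.
Qed.

Lemma parent_anc i x : b <= i < h x -> p (anc i.+1 x) = anc i x.
Proof.
by move=> /andP[bi ix]; rewrite /anc -iterS; congr (iter _ p x); lia.
Qed.

Lemma anc_neq i j x y : b <= i <= j -> j <= h x -> j <= h y ->
  anc i x != anc i y -> anc j x != anc j y.
Proof.
move=> bij jx jy; apply: contraNneq => E.
by rewrite -(anc_anc bij jx) E anc_anc.
Qed.

Lemma low_unique x y : h x < b -> h y < b -> x = y.
Proof.
case: (rooting_base R) => [[c [_ _ lowc _]]|[c [c' [_ _ _ low _]]]].
  by move=> /lowc-> /lowc->.
by rewrite ltnNge low.
Qed.

Definition spine x := (b <= h x) && [exists w, (h w == d) && (x == anc (h x) w)].

Lemma spineP x :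
  reflect (b <= h x /\ exists2 w, h w = d & x = anc (h x) w) (spine x).
Proof.
apply: (iffP andP) => -[bx].
  by case/existsP=> w /andP[/eqP wd /eqP xw]; split=> //; exists w.
by case=> w wd xw; split=> //; apply/existsP; exists w; rewrite wd eqxx -xw eqxx.
Qed.

Lemma spine_anc i w : h w = d -> b <= i <= d -> spine (anc i w).
Proof.
move=> wd bid; have hi : h (anc i w) = i by rewrite height_anc ?wd.
by apply/spineP; rewrite hi; split; [case/andP: bid | exists w].
Qed.

(** By [rooting_aut] every automorphism of the tree is such a permutation. *)
Definition symmetry s := (forall x, h (s x) = h x) /\ (forall x, p (s x) = s (p x)).

Section Symmetry.
Variable s : {perm T}.
Hypothesis sP : symmetry s.

Lemma anc_symmetry i x : anc i (s x) = s (anc i x).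
Proof.
case: sP => hs ps; rewrite /anc hs.
by elim: (h x - i) => //= n ->; rewrite ps.
Qed.

Lemma spine_symmetry x : spine (s x) = spine x.
Proof.
case: sP => hs ps; apply/spineP/spineP; rewrite hs => -[bx [w wd xw]]; split=> //.
  exists ((s^-1)%g w); first by rewrite -(hs ((s^-1)%g w)) permKV.
  by apply: (@perm_inj _ s); rewrite -anc_symmetry permKV.
by exists (s w); rewrite ?hs // anc_symmetry -xw.
Qed.

(** No permutation moves exactly one element of an invariant set. *)
Lemma symmetry_alone x : (forall y, h y = h x -> s y != y -> y = x) -> s x = x.
Proof.
move=> alone; apply/eqP/negPn/negP => sx.
have := alone (s x) (proj1 sP x); rewrite (inj_eq perm_inj) sx => /(_ isT) E.
by rewrite E eqxx in sx.
Qed.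

Lemma symmetry_low x : h x < b -> s x = x.
Proof. by move=> lx; apply: low_unique; rewrite ?(proj1 sP). Qed.

(** With the deepest vertices the whole spine is fixed. Off the spine, only one
    vertex of each level is allowed to move, and [symmetry_alone] applies to it. *)
Lemma symmetry_eq1 : (forall w, h w = d -> s w = w) ->
  (forall x y, h x = h y -> b <= h x -> ~~ spine x -> ~~ spine y ->
     s x != x -> s y != y -> x = y) -> s = 1%g.
Proof.
move=> deepF alone.
have spF x : spine x -> s x = x.
  by case/spineP=> bx [w wd xw]; rewrite xw -anc_symmetry deepF.
apply/permP => x; rewrite perm1.
case: (ltnP (h x) b) => [/symmetry_low//|bx].
case spx: (spine x); first exact: spF.
apply/eqP/negPn/negP => sx; case/negP: (sx); apply/eqP.
apply: symmetry_alone => y yx sy; apply: alone; rewrite ?yx ?spx //.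
by apply: contra sy => /spF/eqP.
Qed.

End Symmetry.

(** [O] is the set of vertices that a symmetry is allowed to move. The sizes
    asked for are those which the two bounds of the theorem leave available. *)
Definition large O := 1 < #|O :&: level d| /\
  forall i, i < d -> minn 3 #|level i| <= #|O :&: level i|.

Definition rigid O := forall s, symmetry s ->
  (forall x, x \notin O -> s x = x) -> s = 1%g.

Lemma large_deep O u v : u \in O -> v \in O -> u != v -> h u = d -> h v = d ->
  1 < #|O :&: level d|.
Proof.
move=> uO vO uv ud vd.
have -> : 2 = #|[set u; v]| by rewrite cards2 uv.
by apply/subset_leq_card/subsetP => x; rewrite !inE => /orP[]/eqP->;
  rewrite ?uO ?vO ?ud ?vd eqxx.
Qed.

Lemma large_all O i : (forall x, h x = i -> x \in O) ->
  minn 3 #|level i| <= #|O :&: level i|.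
Proof.
move=> all_i; apply: leq_trans (geq_minr _ _) _.
apply/subset_leq_card/subsetP => x; rewrite !inE => xi.
by rewrite xi all_i //; apply/eqP.
Qed.

Lemma large_three O i x y z : x \in O -> y \in O -> z \in O ->
  uniq [:: x; y; z] -> h x = i -> h y = i -> h z = i ->
  minn 3 #|level i| <= #|O :&: level i|.
Proof.
move=> xO yO zO U xi yi zi; apply: leq_trans (geq_minl _ _) _.
have /card_uniqP/= <- := U.
by apply/subset_leq_card/subsetP => a; rewrite !inE => /or3P[]/eqP->;
  rewrite ?xO ?yO ?zO ?xi ?yi ?zi eqxx.
Qed.

(** A symmetry that fixes [z] cannot exchange [u] and [v], since [z] shares its
    ancestor of height [b] with [u] and not with [v]. So [u] and [v] can be the
    deepest vertices left free. Any other level frees two vertices of the spine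
    and a third one distinct from [z]; it is fixed as soon as the spine is. When
    [z] itself is an ancestor of [u], the ancestor of [w] replaces it, and a
    fourth vertex is needed in that level to provide the third free one. *)
Lemma rigid_of_asymmetric_triple u v w z : h u = d -> h v = d -> h w = d -> b <= d ->
  anc b u != anc b v -> anc b w != anc b v -> anc b z = anc b u -> z != u ->
  b <= h z -> (h z < d -> anc b w != anc b u /\ 3 < #|level (h z)|) ->
  exists2 O, large O & rigid O.
Proof.
move=> ud vd wd bd uv wv zu neq_zu bz zlow.
have zv i : b <= i <= d -> z != anc i v.
  move=> bid; apply: contraNneq uv => zE.
  by rewrite -zu zE anc_anc // ?vd //; lia.
pose a i := if z == anc i u then anc i w else anc i u.
have ha i : b <= i <= d -> h (a i) = i.
  by move=> bid; rewrite /a; case: ifP => _; rewrite height_anc ?ud ?wd.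
have hv i : b <= i <= d -> h (anc i v) = i by move=> bid; rewrite height_anc ?vd.
have av i : b <= i < d -> a i != anc i v.
  by move=> bid; rewrite /a; case: ifP => _; apply: (@anc_neq b);
    rewrite ?ud ?vd ?wd //; lia.
have za i : b <= i < d -> z != a i.
  move=> bid; rewrite /a; case: ifP => [/eqP zE|->//].
  have hz : h z = i by rewrite zE height_anc // ud; lia.
  have [|wu _] := zlow; first by lia.
  rewrite zE; apply: (@anc_neq b); rewrite ?ud ?wd //; [lia|lia|lia|].
  by rewrite eq_sym.
have spA i : b <= i <= d -> spine (a i).
  by move=> bid; rewrite /a; case: ifP => _; apply: spine_anc.
pose third i := [pick y | (h y == i) && (y \notin [:: a i; anc i v; z])].
have thirdS i y : third i = Some y -> [/\ h y = i, y != a i, y != anc i v & y != z].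
  rewrite /third; case: pickP => // y' /andP[/eqP hy]; rewrite !inE !negb_or.
  by move=> /and3P[? ? ?] [<-].
have thirdN i y : third i = None -> h y = i -> y \in [:: a i; anc i v; z].
  rewrite /third; case: pickP => // /(_ y) + _ hy.
  by rewrite hy eqxx => /negbT; rewrite negbK.
clearbody a third.
pose O := [set x | [|| h x < b, (h x == d) && (x \in [:: u; v])
  | (b <= h x < d) && [|| x == a (h x), x == anc (h x) v | Some x == third (h x)]]].
have Od x : h x = d -> (x \in O) = (x == u) || (x == v).
  by move=> xd; rewrite !inE xd eqxx ltnn ltnNge bd andbF orbF.
have Oi x : b <= h x < d ->
    (x \in O) = [|| x == a (h x), x == anc (h x) v | Some x == third (h x)].
  case/andP=> bx xd; rewrite !inE ltnNge bx xd /=.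
  by case: eqP => // E; rewrite E ltnn in xd.
have Ol x : h x < b -> x \in O by move=> lx; rewrite inE lx.
clearbody O; exists O.
- split.
    apply: (@large_deep O u v); rewrite ?Od ?eqxx ?orbT //.
    by apply: contraNneq uv => ->.
  move=> i id; case: (ltnP i b) => [ib|bi].
    by apply: large_all => x xi; apply: Ol; rewrite xi.
  have bid : b <= i <= d by rewrite bi ltnW.
  have aO : a i \in O by rewrite Oi ha // ?bi ?eqxx.
  have vO : anc i v \in O by rewrite Oi hv // ?bi ?eqxx ?orbT.
  case E: (third i) => [y|].
    have [hy ya yv yz] := thirdS _ _ E.
    apply: (@large_three O i (a i) (anc i v) y); rewrite ?ha ?hv //.
      by rewrite Oi hy ?bi // E ?eqxx ?orbT.
    by rewrite /= !inE negb_or av ?bi // eq_sym ya eq_sym yv.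
  apply: large_all => x xi; have := thirdN i x E xi.
  rewrite !inE => /or3P[]/eqP xE; [by rewrite xE|by rewrite xE|].
  have hz : h z = i by rewrite -xE.
  have [|_] := zlow; first by rewrite hz.
  rewrite hz ltnNge; case/negP; apply: leq_trans (card_size [:: a i; anc i v; z]).
  by apply/subset_leq_card/subsetP => y; rewrite inE => /eqP/(thirdN i y E).
- move=> s sP sO; have [hs ps] := sP.
  have zF : s z = z.
    apply: sO; case: (ltnP (h z) d) => [zd|dz].
      have bzd : b <= h z < d by rewrite bz zd.
      have bzd' : b <= h z <= d by rewrite bz ltnW.
      rewrite (Oi _ bzd) !negb_or (za _ bzd) (zv _ bzd') /=.
      by apply/eqP => /esym/thirdS[_ _ _]; rewrite eqxx.
    have zd : h z = d by apply/eqP; rewrite eqn_leq dz (rooting_le R).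
    by rewrite Od // negb_or neq_zu -[v]anc_id vd zv // bd leqnn.
  have deepO x : h x = d -> s x != x -> x = u \/ x = v.
    move=> xd sx; have : x \in O by apply: contraR sx => /sO/eqP.
    by rewrite Od // => /orP[]/eqP; [left|right].
  have uF : s u = u.
    apply/eqP/negPn/negP => su; have sud : h (s u) = d by rewrite hs.
    have ssu : s (s u) != s u by rewrite (inj_eq perm_inj).
    case: (deepO _ sud ssu) => E; first by rewrite E eqxx in su.
    by case/eqP: uv; rewrite -E (anc_symmetry sP) -zu -(anc_symmetry sP) zF.
  apply: (symmetry_eq1 sP).
    move=> w' wd'; apply/eqP/negPn/negP => sw.
    case: (deepO _ wd' sw) => wE; first by rewrite wE uF eqxx in sw.
    case/eqP: (sw); rewrite wE; apply: (symmetry_alone sP) => y; rewrite vd => yd sy.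
    by case: (deepO _ yd sy) => // yE; rewrite yE uF eqxx in sy.
  have pickO x : b <= h x -> ~~ spine x -> s x != x -> Some x = third (h x).
    move=> bx spx sx; have : x \in O by apply: contraR sx => /sO/eqP.
    have spd : h x < d.
      rewrite ltn_neqAle (rooting_le R) andbT; apply: contraNN spx => /eqP xd.
      by rewrite -[x]anc_id; apply: spine_anc; rewrite ?xd ?bd ?leqnn.
    have bxd : b <= h x <= d by rewrite bx ltnW.
    rewrite Oi ?bx // => /or3P[]/eqP // xE; case/negP: spx; rewrite xE.
      exact: spA.
    exact: spine_anc.
  move=> x y xy bx spx spy sx sy.
  have := pickO x bx spx sx; rewrite xy => E.
  by have := pickO y; rewrite -xy => /(_ bx spy sy); rewrite xy -E => -[].
Qed.

End Rooting.

(** * Fixing sets and colourings from rigid sets; spines with two or three legs *)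

Section Bounds.
Variables (T : finType) (e : rel T) (h : T -> nat) (p : T -> T) (b d : nat).
Hypothesis R : rooting e h p b d.
Implicit Types (u v w x y z : T) (s : {perm T}) (O : {set T}) (k : nat).
Local Notation anc := (anc h p).
Local Notation symmetry := (symmetry h p).
Local Notation spine := (spine h p b d).
Local Notation level := (level h).

Definition colourable k := exists2 col : T -> nat, forall x, col x < k
  & forall s, symmetry s -> (forall x, col (s x) = col x) -> s = 1%g.

Lemma colourable_distinguishing k : colourable k -> distinguishing_number e <= k.
Proof.
case=> col ltk colP; rewrite /distinguishing_number; case: ex_minnP => n _; apply.
apply/existsP; exists [ffun x => Ordinal (ltk x)].
apply/forallP => s; apply/implyP => /andP[sA /forallP sC].
apply/eqP; apply: colP; first exact: (rooting_aut R).
by move=> x; have := sC x; rewrite !ffunE => /eqP[].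
Qed.

Lemma rigid_fixing O : rigid h p O -> fixing_number e <= #|~: O|.
Proof.
move=> rO; rewrite /fixing_number; case: ex_minnP => n _; apply.
apply/existsP; exists (~: O); rewrite eqxx andbT.
apply/forallP => s; apply/implyP => /andP[sA /forall_inP sC].
apply/eqP; apply: rO; first exact: (rooting_aut R).
by move=> x xO; apply/eqP/sC; rewrite inE.
Qed.

(** One colour for all of [O], and distinct further colours for the rest of each
    level: a symmetry that preserves this colouring fixes all vertices outside
    [O]. *)
Lemma rigid_colourable O k : large h d O -> rigid h p O -> #|level d| <= k.+1 ->
  (forall i, i < d -> #|level i| <= k.+2) -> colourable k.
Proof.
case=> lO lO' rO kd ki.
have k0 : 0 < k.
  have : #|O :&: level d| <= #|level d| by rewrite subset_leq_card ?subsetIr.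
  by lia.
pose D x := enum (level (h x) :\: O).
have memD x : x \notin O -> x \in D x by move=> xO; rewrite mem_enum !inE xO eqxx.
exists (fun x => if x \in O then 0 else (index x (D x)).+1) => [x|s sP sC].
  case: ifPn => // xO; have := memD _ xO; rewrite -index_mem -cardE.
  have := cardsID O (level (h x)); rewrite setIC.
  case: (ltnP (h x) d) => [xd|dx].
    by have := lO' _ xd; have := ki _ xd; lia.
  have -> : h x = d by apply/eqP; rewrite eqn_leq dx (rooting_le R).
  by lia.
apply: rO => // x xO; have := sC x; rewrite (negPf xO).
case: ifPn => // sxO [].
have hs : D (s x) = D x by rewrite /D (proj1 sP).
rewrite hs => ind.
by rewrite -[s x](nth_index x (memD _ sxO)) hs ind nth_index // memD.
Qed.

Section TwoLegs.
Variables u v : T.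
Hypotheses (bd : b <= d) (ud : h u = d) (vd : h v = d).
Hypothesis uv : anc b u != anc b v.
Hypothesis two : forall w, h w = d -> w = u \/ w = v.

Lemma two_spine x : spine x -> x = anc (h x) u \/ x = anc (h x) v.
Proof.
by case/spineP=> bx [w /two[]->]; [left|right].
Qed.

Lemma nonspine_lt x : ~~ spine x -> h x < d.
Proof.
move=> spx; rewrite ltn_neqAle (rooting_le R) andbT; apply: contraNN spx => /eqP xd.
by rewrite -[x](anc_id h p); apply: (spine_anc R); rewrite // xd bd /=.
Qed.

(** The parent of a vertex fails to be lower only at one of two centres, and
    these are both on the spine. *)
Lemma nonspine_parent x : ~~ spine x -> b <= h x -> h (p x) < h x.
Proof.
move=> spx; rewrite leq_eqVlt => /predU1P[bx|bx]; last first.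
  by rewrite (rooting_parent R) //; lia.
case: (rooting_base R) => [[c [_ cb _ pc]]|[c [c' [_ _ _ _ cc']]]].
  by rewrite pc // -bx.
have bbd : b <= b <= d by rewrite leqnn.
have hu : h (anc b u) = b by rewrite (height_anc R) // ud.
have hv : h (anc b v) = b by rewrite (height_anc R) // vd.
case/negP: spx.
suff: x = anc b u \/ x = anc b v by case=> ->; apply: (spine_anc R).
move: uv; case: (cc' _ hu) => ->; case: (cc' _ hv) => ->; rewrite ?eqxx // => _.
  by case: (cc' x (esym bx)) => ->; [left|right].
by case: (cc' x (esym bx)) => ->; [right|left].
Qed.

Lemma leg_neq i : b <= i <= d -> anc i u != anc i v.
Proof. by move=> bid; apply: (anc_neq R (i := b)); rewrite ?ud ?vd //; lia. Qed.

(** A symmetry either preserves or exchanges the two legs of the spine, and a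
    fixed vertex of one leg excludes the exchange. *)
Lemma spine_fixed s x : symmetry s -> spine x -> s x = x ->
  forall w, h w = d -> s w = w.
Proof.
move=> sP spx sx w wd; have [hs ps] := sP.
have bx : b <= h x <= d by case/andP: spx => ->; rewrite (rooting_le R).
have neq := leg_neq bx.
have su : s u = u.
  case: (two (w := s u)); rewrite ?hs // => su.
  have E := anc_symmetry sP (h x) u; rewrite su in E.
  case: (two_spine spx) => xE; case/eqP: neq.
    by rewrite E -xE sx.
  by apply: (@perm_inj _ s); rewrite -E -xE sx.
have sv : s v = v.
  case: (two (w := s v)); rewrite ?hs // => sv.
  by case/eqP: uv; congr (anc b _); apply: (@perm_inj _ s); rewrite su sv.
by case: (two wd) => ->.
Qed.

Definition pick_nonspine i := [pick y | (h y == i) && ~~ spine y].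

Lemma pick_nonspineS i y : pick_nonspine i = Some y -> h y = i /\ ~~ spine y.
Proof. by rewrite /pick_nonspine; case: pickP => // y' /andP[/eqP? ?] [<-]. Qed.

Lemma pick_nonspineN i y : pick_nonspine i = None -> h y = i -> spine y.
Proof.
rewrite /pick_nonspine; case: pickP => // /(_ y) + _ hy.
by rewrite hy eqxx => /negbT; rewrite negbK.
Qed.

(** A symmetry that moves only these vertices fixes the one that is off the spine
    in each level, so it can do no more than exchange the two legs. *)
Definition loose := [set x | [|| h x < b, spine x | Some x == pick_nonspine (h x)]].

Lemma loose_large_at O i : (forall x, h x = i -> (x \in O) = (x \in loose)) ->
  i < d -> minn 3 #|level i| <= #|O :&: level i|.
Proof.
move=> OE id; case: (ltnP i b) => [ib|bi].
  by apply: large_all => x xi; rewrite OE // inE xi ib.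
have bid : b <= i <= d by rewrite bi ltnW.
have hu : h (anc i u) = i by rewrite (height_anc R) // ud.
have hv : h (anc i v) = i by rewrite (height_anc R) // vd.
have su : spine (anc i u) by apply: (spine_anc R).
have sv : spine (anc i v) by apply: (spine_anc R).
case E: (pick_nonspine i) => [y|].
  have [hy sy] := pick_nonspineS E.
  apply: (@large_three _ _ O i (anc i u) (anc i v) y) => //.
  - by rewrite OE // inE su orbT.
  - by rewrite OE // inE sv orbT.
  - by rewrite OE // inE hy E eqxx !orbT.
  rewrite /= !inE negb_or leg_neq //=.
  by apply/and3P; split=> //; apply: contraNneq sy => <-.
by apply: large_all => x xi; rewrite OE // inE (pick_nonspineN E) ?orbT.
Qed.

Lemma loose_deep O : (forall x, h x = d -> (x \in O) = (x \in loose)) ->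
  1 < #|O :&: level d|.
Proof.
move=> OE; have bdd : b <= d <= d by rewrite bd leqnn.
have mem w : h w = d -> w \in O.
  by move=> wd; rewrite OE // inE -[w](anc_id h p) wd (spine_anc R) ?orbT.
apply: (@large_deep _ _ _ O u v); rewrite ?mem //.
by apply: contraNneq uv => ->.
Qed.

Lemma loose_fixed s x : symmetry s -> ~~ spine x ->
  (forall y, h y = h x -> s y != y -> y \in loose) -> s x = x.
Proof.
move=> sP spx sO; case: (ltnP (h x) b) => [/(symmetry_low R sP)//|bx].
apply/eqP/negPn/negP => sx.
have sp y : h y = h x -> ~~ spine y -> s y != y -> Some y = pick_nonspine (h x).
  move=> hy spy sy; have := sO _ hy sy.
  by rewrite inE (negPf spy) hy ltnNge bx => /eqP.
have [hs _] := sP; have := sp (s x) (hs x).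
rewrite (spine_symmetry b d sP) // (inj_eq perm_inj) sx -(sp x) // => /(_ spx isT)[E].
by rewrite E eqxx in sx.
Qed.

(** The spine is pinned down by the vertex of a leg to which [x] is attached. *)
Lemma rigid_of_attached x : ~~ spine x -> spine (p x) ->
  exists2 O, large h d O & rigid h p O.
Proof.
move=> spx spp; exists loose.
  split=> [|i id]; [exact: loose_deep|exact: loose_large_at].
move=> s sP sO.
have sL y : s y != y -> y \in loose by apply: contraR => /sO/eqP.
have nsF y : ~~ spine y -> s y = y.
  by move=> spy; apply: loose_fixed => // z _; apply: sL.
apply: (symmetry_eq1 R sP).
  by apply: (spine_fixed sP spp); rewrite -(proj2 sP) nsF.
by move=> y z _ _ /nsF->; rewrite eqxx.
Qed.

(** In the level of [x] and [y], a vertex of one leg is kept fixed in order to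
    pin down the spine, and in return both [x] and [y] are free. They cannot be
    exchanged unless they are leaves with the same parent. *)
Lemma rigid_of_pair x y : ~~ spine x -> ~~ spine y -> b <= h x -> h y = h x ->
  x != y -> p x != p y \/ (exists z, b < h z /\ (p z = x \/ p z = y)) ->
  exists2 O, large h d O & rigid h p O.
Proof.
move=> spx spy bx yx neq sep.
have xd := nonspine_lt spx; move jE: (h x) bx yx xd => j bx yx xd.
have bjd : b <= j <= d by rewrite bx ltnW.
have hv : h (anc j v) = j by rewrite (height_anc R) // vd.
have hu : h (anc j u) = j by rewrite (height_anc R) // ud.
have spu : spine (anc j u) by apply: (spine_anc R).
have spv : spine (anc j v) by apply: (spine_anc R).
pose O := [set z | if h z == j then z \in [:: anc j v; x; y] else z \in loose].
have Oj z : h z = j -> (z \in O) = (z \in [:: anc j v; x; y]).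
  by move=> zj; rewrite inE zj eqxx.
have Oi z : h z != j -> (z \in O) = (z \in loose).
  by move=> zj; rewrite inE (negPf zj).
clearbody O; exists O.
  split=> [|i id]; first by apply: loose_deep => z zd; rewrite Oi // zd; lia.
  case: (eqVneq i j) => [->|ij]; last first.
    by apply: loose_large_at => // z zi; rewrite Oi // zi.
  apply: (@large_three _ _ O j (anc j v) x y); rewrite ?Oj // ?inE ?eqxx ?orbT //.
  rewrite /= !inE negb_or neq !andbT /=.
  by apply/andP; split; [apply: contraNneq spx|apply: contraNneq spy] => <-.
move=> s sP sO; have [hs ps] := sP.
have sL z : s z != z -> z \in O by apply: contraR => /sO/eqP.
have nsF z : ~~ spine z -> h z != j -> s z = z.
  move=> spz zj; apply: loose_fixed => // z' hz' sz'.
  by rewrite -Oi ?hz' //; apply: sL.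
have deepF : forall w, h w = d -> s w = w.
  apply: (spine_fixed sP spu); apply: sO; rewrite Oj // !inE !negb_or leg_neq //=.
  by apply/andP; split; [apply: contraNneq spx|apply: contraNneq spy] => <-.
have spF z : spine z -> s z = z.
  by case/spineP=> bz [w wd zw]; rewrite zw -(anc_symmetry sP) deepF.
have offF z : h z != j -> s z = z.
  by move=> zj; case spz: (spine z); [apply: spF|apply: nsF; rewrite ?spz].
have onF z : ~~ spine z -> h z = j -> s z != z -> z = x \/ z = y.
  move=> spz zj /sL; rewrite Oj // !inE => /or3P[]/eqP; [|by left|by right].
  by move=> E; rewrite E spv in spz.
have moved z : ~~ spine z -> h z = j -> s z != z ->
    ~~ spine (s z) /\ h (s z) = j /\ s (s z) != s z.
  by move=> spz zj sz; rewrite (spine_symmetry b d sP) // hs (inj_eq perm_inj).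
have xF : s x = x.
  apply/eqP/negPn/negP => sx.
  have [spx' [xj' sx']] := moved x spx jE sx.
  have sxE : s x = y by case: (onF _ spx' xj' sx') => // E; rewrite E eqxx in sx.
  have pxF : s (p x) = p x.
    by apply: offF; have := nonspine_parent spx; rewrite jE neq_ltn => ->.
  case: sep => [/eqP[]|[z [bz pz]]]; first by rewrite -pxF -ps sxE.
  have hz : h (p z) = (h z).-1 by rewrite (rooting_parent R).
  have jz : j = (h z).-1 by rewrite -hz; case: pz => ->.
  have zF : s z = z.
    by apply: offF; rewrite jz eq_sym ltn_eqF // ltn_predL (leq_ltn_trans _ bz).
  have := ps z; rewrite zF; case: pz => ->.
    by move=> E; rewrite -E eqxx in sx.
  by rewrite -sxE => /perm_inj E; rewrite -E eqxx in sx.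
have yF : s y = y.
  apply/eqP/negPn/negP => sy.
  have [spy' [yj' sy']] := moved y spy yx sy.
  case: (onF _ spy' yj' sy') => E; last by rewrite E eqxx in sy.
  by rewrite E xF eqxx in sy'.
apply: (symmetry_eq1 R sP) => // z z' _ bz spz _ sz _.
case: (eqVneq (h z) j) => [zj|/offF zF]; last by rewrite zF eqxx in sz.
by case: (onF _ spz zj sz) => E; rewrite E ?xF ?yF eqxx in sz.
Qed.

(** At most [k] vertices of each level are off the spine, and they get distinct
    colours. The pair shows that [k >= 2], so that two colours are available to
    tell the legs apart in one level. *)
Lemma colourable_of_pair x y k : ~~ spine x -> ~~ spine y -> b <= h x -> h y = h x ->
  x != y -> (forall i, i < d -> #|level i| <= k.+2) -> colourable k.
Proof.
move=> spx spy bx yx neq ki.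
pose D z := [set y | (h y == h z) && ~~ spine y].
have xd := nonspine_lt spx; move jE: (h x) bx yx xd => j bx yx xd.
have bjd : b <= j <= d by rewrite bx ltnW.
have hu : h (anc j u) = j by rewrite (height_anc R) // ud.
have spu : spine (anc j u) by apply: (spine_anc R).
have Dk z : b <= h z -> ~~ spine z -> #|D z| <= k.
  move=> bz spz; have zd := nonspine_lt spz.
  have bzd : b <= h z <= d by rewrite bz ltnW.
  pose A := [set anc (h z) u; anc (h z) v].
  have AD : #|A :|: D z| = #|D z|.+2.
    rewrite cardsU cards2 leg_neq //.
    rewrite [_ :&: _](_ : _ = set0) ?cards0; first by rewrite subn0.
    apply/setP => a; rewrite !inE; apply/negbTE; rewrite negb_and orbC -implybE.
    apply/implyP => /andP[_ spa]; rewrite negb_or.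
    by apply/andP; split; apply: contraNneq spa => ->; apply: (spine_anc R).
  rewrite -(leq_add2r 2) !addn2 -AD; apply: leq_trans (ki _ zd).
  apply/subset_leq_card/subsetP => a; rewrite !inE.
  by case/orP=> [/orP[]/eqP->|/andP[]//]; rewrite (height_anc R) ?ud ?vd.
have k2 : 2 <= k.
  have bhx : b <= h x by rewrite jE.
  apply: leq_trans (Dk x bhx spx).
  have -> : 2 = #|[set x; y]| by rewrite cards2 neq.
  apply/subset_leq_card/subsetP => a; rewrite !inE.
  by case/orP=> /eqP->; rewrite ?yx ?jE ?eqxx.
pose col z := if h z < b then 0 else if spine z then nat_of_bool (z == anc j u)
              else index z (enum (D z)).
have memD z : ~~ spine z -> z \in enum (D z).
  by move=> spz; rewrite mem_enum inE eqxx.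
exists col => [z|s sP sC].
  rewrite /col; case: (ltnP (h z) b) => [_|bz]; first by lia.
  case: ifPn => [_|spz]; first by case: eqP => _; lia.
  by apply: leq_trans (Dk z bz spz); rewrite cardE index_mem memD.
have [hs ps] := sP.
have nsF z : b <= h z -> ~~ spine z -> s z = z.
  move=> bz spz; have := sC z.
  rewrite /col hs ltnNge bz (spine_symmetry b d sP) (negPf spz) /=.
  have -> : D (s z) = D z by rewrite /D hs.
  move=> E; rewrite -[s z](nth_index z (s := enum (D z))); last first.
    have -> : D z = D (s z) by rewrite /D hs.
    by apply: memD; rewrite (spine_symmetry b d sP).
  by rewrite E nth_index // memD.
apply: (symmetry_eq1 R sP).
  apply: (spine_fixed sP spu); have := sC (anc j u).
  rewrite /col hs hu ltnNge bx (spine_symmetry b d sP) spu eqxx /=.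
  by case: eqP.
by move=> z z' _ bz spz _; rewrite nsF // eqxx.
Qed.

End TwoLegs.

(** Two colours suffice: the second one marks the deepest vertex of the leg of
    [w] and the top vertices of all legs but that of [u]. *)
Lemma three_legs_colourable u v w k : b < d -> h u = d -> h v = d -> h w = d ->
  anc b u != anc b v -> anc b u != anc b w -> anc b v != anc b w ->
  (forall x, b <= h x -> [\/ x = anc (h x) u, x = anc (h x) v | x = anc (h x) w]) ->
  #|level d| <= k.+1 -> colourable k.
Proof.
move=> bd ud vd wd uv uw vw all kd.
have deepE x : h x = d -> [\/ x = u, x = v | x = w].
  have E y : h y = d -> anc d y = y by move=> <-; apply: anc_id.
  by move=> xd; have := all x; rewrite xd (ltnW bd) !E //; apply.
have neq x y : anc b x != anc b y -> x != y by apply: contraNneq => ->.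
have k2 : 2 <= k.
  rewrite -ltnS; apply: leq_trans kd.
  have U : uniq [:: u; v; w].
    by rewrite /= !inE negb_or (neq _ _ uv) (neq _ _ uw) (neq _ _ vw).
  rewrite -[3]/(size [:: u; v; w]) -(card_uniqP U).
  by apply/subset_leq_card/subsetP => a; rewrite !inE => /or3P[]/eqP->; apply/eqP.
exists (fun x => nat_of_bool ((x == w) || (h x == b) && (x != anc b u))) => [x|s sP sC].
  by case: (_ || _); lia.
have [hs ps] := sP; have bb : b <= b <= d by rewrite leqnn ltnW.
have hu : h (anc b u) = b by rewrite (height_anc R) // ud.
have wF : s w = w.
  have := sC w; rewrite eqxx hs wd gtn_eqF //= orbF; by case: eqP.
have uF : s (anc b u) = anc b u.
  have uw' : (anc b u == w) = false.
    by apply/negbTE; apply: contraTneq bd => uw'; rewrite -hu uw' wd ltnn.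
  have := sC (anc b u); rewrite hs hu !eqxx uw' /=.
  by case: (_ == w) => //; case: eqP.
have suF : s u = u.
  have E : anc b (s u) = anc b u by rewrite (anc_symmetry sP).
  case: (deepE (s u)); rewrite ?hs // => su; rewrite su in E.
    by rewrite E eqxx in uv.
  by rewrite E eqxx in uw.
apply: (symmetry_eq1 R sP).
  move=> x xd; case: (deepE x xd) => -> //.
  case: (deepE (s v)); rewrite ?hs // => sv.
    by move: sv; rewrite -{1}suF => /perm_inj E; rewrite E eqxx in uv.
  by move: sv; rewrite -{1}wF => /perm_inj E; rewrite E eqxx in vw.
move=> x y _ bx spx; case/negP: spx; have bxd : b <= h x <= d by rewrite bx (rooting_le R).
by case: (all x bx) => ->; apply: (spine_anc R).
Qed.

End Bounds.

(** * Recognizing paths, stars, spiders and brooms *)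

Lemma path_graph_sym n : symmetric (path_graph n).
Proof. by move=> i j; rewrite /path_graph orbC. Qed.

Lemma path_graph_irr n : irreflexive (path_graph n).
Proof. by move=> i; rewrite /path_graph eqn_leq ltnn. Qed.

Lemma spider_graph_sym ks : symmetric (spider_graph ks).
Proof. by move=> [x|] [y|] //=; rewrite eq_sym orbC. Qed.

Lemma spider_graph_irr ks : irreflexive (spider_graph ks).
Proof. by move=> [x|] //=; rewrite eqxx eqn_leq ltnn. Qed.

Lemma spider_vertex_inj ks (x y : {i : 'I_(size ks) & 'I_(nth 0 ks i)}) :
  tag x = tag y :> nat -> tagged x = tagged y :> nat -> x = y.
Proof.
case: x y => [i j] [i' j'] /= /val_inj ii'; case: _ / ii' in j' *.
by move=> /val_inj->.
Qed.

Lemma spider_vertex_at ks i j : i < size ks -> j < nth 0 ks i ->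
  exists x : {i : 'I_(size ks) & 'I_(nth 0 ks i)},
    tag x = i :> nat /\ tagged x = j :> nat.
Proof.
move=> li lj.
by exists (existT (fun i : 'I_(size ks) => 'I_(nth 0 ks i)) (Ordinal li) (Ordinal lj)).
Qed.

Section Isomorphisms.
Variables (T : finType) (e : rel T) (h : T -> nat) (p : T -> T) (b d : nat).
Hypothesis R : rooting e h p b d.
Implicit Types (u v w x y z : T).
Local Notation anc := (anc h p).

(** Since the edges of the tree are the pairs formed by a vertex and its parent,
    it is enough that [g] sends edges of the model to such pairs, and that each
    such pair comes from an edge of the model. *)
Lemma graph_iso_of_parent (M : finType) (eM : rel M) (g : M -> T) :
  symmetric eM -> irreflexive eM -> injective g -> (forall x, exists a, g a = x) ->
  (forall a a', eM a a' -> p (g a) = g a' \/ p (g a') = g a) ->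
  (forall a, p (g a) = g a \/ exists2 a', eM a a' & p (g a) = g a') ->
  graph_iso e eM.
Proof.
move=> sym irr inj surj E1 E2.
have [f gK fK] : bijective g.
  apply: (inj_card_bij inj); have <- : #|codom g| = #|T|.
    by apply: eq_card => x; have [a <-] := surj x; rewrite codom_f.
  by rewrite (card_codom inj).
exists f; first by exists g.
have eg a a' : e (g a) (g a') = eM a a'.
  have up c c' : p (g c) = g c' -> c != c' -> eM c c'.
    move=> pc neq; case: (E2 c) => [E|[c'' ec E]].
      by move/inj: (etrans (esym E) pc) => E'; rewrite E' eqxx in neq.
    by have /inj-> : g c' = g c'' by rewrite -pc.
  rewrite (rooting_edge R) (inj_eq inj); apply/andP/idP => [[neq]|ea].
    case/orP=> /eqP pa; first exact: up.
    by rewrite sym; apply: up; rewrite // eq_sym.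
  split; first by apply: contraTneq ea => ->; rewrite irr.
  by case: (E1 _ _ ea) => ->; rewrite eqxx ?orbT.
by move=> x y; rewrite -{2}[x]fK -{2}[y]fK eg.
Qed.

Lemma iter_anc n w : n <= h w - b -> b <= h w -> iter n p w = anc (h w - n) w.
Proof. by move=> le_n bw; rewrite /anc; congr (iter _ p w); lia. Qed.

Section TwoLegs.
Variables (u v : T) (n : nat).
Hypotheses (bd : b <= d) (ud : h u = d) (vd : h v = d).
Hypothesis uv : anc b u != anc b v.
Local Notation a := (d - b).+1.
Hypothesis nE : n = (2 * a).+1 /\ h (iter a p v) < b \/ n = 2 * a.
Hypothesis join : iter a p u = iter (n.-1 - a) p v.

(** From [u] along its leg to the centre, then along the other leg to [v]. With
    a single centre, this centre is at position [a]; with two of them, they are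
    at positions [a.-1] and [a]. *)
Definition legs i := if i < a then iter i p u else iter (n.-1 - i) p v.

Lemma legs_left i : i < a -> h (legs i) = d - i /\ anc b (legs i) = anc b u.
Proof.
move=> ia; rewrite /legs ia iter_anc ?ud //; try lia.
by rewrite (height_anc R) ?(anc_anc R) ?ud //; lia.
Qed.

Lemma legs_right i : a <= i -> n.-1 - i < a ->
  h (legs i) = d - (n.-1 - i) /\ anc b (legs i) = anc b v.
Proof.
move=> ai ia; rewrite /legs (leq_gtF ai) iter_anc ?vd //; try lia.
by rewrite (height_anc R) ?(anc_anc R) ?vd //; lia.
Qed.

Lemma legs_middle i : i < n -> a <= i -> a <= n.-1 - i -> i = a /\ h (legs i) < b.
Proof.
case: nE => [[nE' low]|nE'] ltn ai ia; last by lia.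
have ia' : i = a by lia.
by split=> //; rewrite /legs (leq_gtF ai); have -> : n.-1 - i = a by lia.
Qed.

Lemma legs_inj i j : i < n -> j < n -> legs i = legs j -> i = j.
Proof.
wlog ij : i j / i <= j => [H|] ltn_i ltn_j E.
  by case/orP: (leq_total i j) => ij; [|symmetry]; apply: H.
case: (ltnP i a) => ia.
  have [hi bi] := legs_left ia; case: (ltnP j a) => ja.
    by have [hj _] := legs_left ja; rewrite -E hi in hj; lia.
  case: (ltnP (n.-1 - j) a) => ja'.
    by have [_ bj] := legs_right ja ja'; case/eqP: uv; rewrite -bi -bj E.
  by have [_ hj] := legs_middle ltn_j ja ja'; rewrite -E hi in hj; lia.
have ja := leq_trans ia ij.
case: (ltnP (n.-1 - i) a) => ia'.
  have [hi _] := legs_right ia ia'; case: (ltnP (n.-1 - j) a) => ja'.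
    by have [hj _] := legs_right ja ja'; rewrite -E hi in hj; lia.
  by have [_ hj] := legs_middle ltn_j ja ja'; rewrite -E hi in hj; lia.
have [iE hi] := legs_middle ltn_i ia ia'.
case: (ltnP (n.-1 - j) a) => ja'; last first.
  by have [-> _] := legs_middle ltn_j ja ja'.
by have [hj _] := legs_right ja ja'; rewrite -E in hj; lia.
Qed.

Lemma legs_up i : i < a -> p (legs i) = legs i.+1.
Proof.
move=> ia; rewrite /legs ia; case: ltnP => [//|ai].
have -> : i.+1 = a by lia.
by rewrite -join -iterS; congr (iter _ p u); lia.
Qed.

Lemma legs_down i : a <= i -> i.+1 < n -> p (legs i.+1) = legs i.
Proof.
move=> ai ltn; rewrite /legs (leq_gtF ai) (leq_gtF (leqW ai)) -iterS.
by congr (iter _ p v); lia.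
Qed.

Lemma legs_onto x : b <= h x -> x = anc (h x) u \/ x = anc (h x) v ->
  exists2 i, i < n & legs i = x.
Proof.
move=> bx; have xd := rooting_le R x; case=> xE.
  exists (d - h x); first by lia.
  by rewrite /legs ifT ?iter_anc ?ud ?subKn //; lia.
exists (n.-1 - (d - h x)); first by lia.
rewrite /legs ifN; last by lia.
by rewrite subKn ?iter_anc ?vd ?subKn //; lia.
Qed.

Lemma legs_edge i : i.+1 < n -> p (legs i) = legs i.+1 \/ p (legs i.+1) = legs i.
Proof.
by case: (ltnP i a) => ia ltn; [left; apply: legs_up|right; apply: legs_down].
Qed.

Lemma legs_parent (i : 'I_n) : p (legs a) = legs a \/ p (legs a) = legs a.-1 ->
  p (legs i) = legs i \/ exists2 j : 'I_n, path_graph n i j & p (legs i) = legs j.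
Proof.
move=> root; have an : a < n by case: nE => [[->]|->]; lia.
case: (ltnP i a) => ia.
  right; have ltn : i.+1 < n by lia.
  by exists (Ordinal ltn); rewrite /path_graph /= ?eqxx // legs_up.
case: (eqVneq (i : nat) a) => [ia'|ia'].
  rewrite ia'; case: root => [|E]; [by left|right].
  have ltn : a.-1 < n by lia.
  by exists (Ordinal ltn); rewrite // /path_graph ia' /= eqxx orbT.
have i0 : 0 < i by lia.
right; have ltn : i.-1 < n by have := ltn_ord i; lia.
exists (Ordinal ltn); first by rewrite /path_graph /= prednK // eqxx orbT.
by have E := @legs_down i.-1; rewrite prednK // in E; rewrite /= E //; lia.
Qed.

(** The legs meet in a vertex or in an edge. *)
Lemma path_iso : p (legs a) = legs a \/ p (legs a) = legs a.-1 ->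
  (forall x, exists2 i, i < n & legs i = x) -> graph_iso e (path_graph n).
Proof.
move=> root onto.
apply: (graph_iso_of_parent (g := fun i : 'I_n => legs i)).
- exact: path_graph_sym.
- exact: path_graph_irr.
- by move=> i j /legs_inj E; apply/val_inj/E.
- by move=> x; have [i ltn <-] := onto x; exists (Ordinal ltn).
- move=> i j /orP[]/eqP E; rewrite -E; [|apply/or_comm]; apply: legs_edge;
    rewrite E; exact: ltn_ord.
- by move=> i; apply: legs_parent.
Qed.

End TwoLegs.

Section OneCentre.
Variable c : T.
Hypotheses (pc : p c = c) (cb : h c < b).
Hypotheses (lowc : forall x, h x < b -> x = c) (topc : forall x, h x = b -> p x = c).

Lemma iter_centre w : b <= h w -> iter (h w - b).+1 p w = c.
Proof.
move=> bw; rewrite iterS (iter_anc (n := h w - b)) // topc // (height_anc R) //; lia.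
Qed.

Lemma parent_leg w i : b <= i <= h w ->
  p (anc i w) = if i == b then c else anc i.-1 w.
Proof.
move=> biw; case: eqP => [ib|/eqP ib]; first by rewrite topc // (height_anc R).
have -> : i = i.-1.+1 by lia.
by rewrite (@parent_anc _ h p b) //; lia.
Qed.

Lemma star_iso : (forall x, b <= h x -> h x = b) ->
  graph_iso e (star_graph #|level h b|).
Proof.
move=> allb; pose A := level h b.
pose g (a : option 'I_#|A|) := if a is Some i then enum_val i else c.
have hg i : h (g (Some i)) = b.
  by have := enum_valP i; rewrite inE => /eqP.
apply: (graph_iso_of_parent (g := g)).
- by move=> [i|] [j|].
- by move=> [i|].
- move=> [i|] [j|] // E; first by congr Some; apply: enum_val_inj.
    by move: cb; rewrite -[c]/(g None) -E hg ltnn.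
  by move: cb; rewrite -[c]/(g None) E hg ltnn.
- move=> x; case: (ltnP (h x) b) => [/lowc->|bx]; first by exists None.
  have xA : x \in A by rewrite inE allb.
  by exists (Some (enum_rank_in xA x)); rewrite /g enum_rankK_in.
- by move=> [i|] [j|] // _; [left|right]; rewrite topc ?hg.
- by move=> [i|]; [right; exists None; rewrite ?topc ?hg|left].
Qed.

Lemma spider_iso ws : all (fun w => b <= h w) ws -> uniq [seq anc b w | w <- ws] ->
  (forall x, b <= h x -> exists2 w, w \in ws & h x <= h w /\ x = anc (h x) w) ->
  graph_iso e (spider_graph [seq (h w - b).+1 | w <- ws]).
Proof.
move=> ball U surj; set ks := map _ ws.
have sz : size ks = size ws by rewrite size_map.
pose W i := nth c ws i.
have kW i : i < size ks -> nth 0 ks i = (h (W i) - b).+1.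
  by rewrite sz => li; rewrite (nth_map c).
have bW i : i < size ks -> b <= h (W i).
  by rewrite sz => li; apply: (allP ball); rewrite mem_nth.
pose g (a : spider_vertex ks) :=
  if a is Some x then anc (b + tagged x) (W (tag x)) else c.
have lt (x : {i : 'I_(size ks) & 'I_(nth 0 ks i)}) : b <= b + tagged x <= h (W (tag x)).
  
  have := bW _ (ltn_ord (tag x)); have := kW _ (ltn_ord (tag x)).
  by have := ltn_ord (tagged x); lia.
have hg (x : {i : 'I_(size ks) & 'I_(nth 0 ks i)}) : h (g (Some x)) = b + tagged x.
  by rewrite (height_anc R).
have bg (x : {i : 'I_(size ks) & 'I_(nth 0 ks i)}) :
    anc b (g (Some x)) = anc b (W (tag x)).
  by rewrite /g (anc_anc R) ?leqnn //=; case/andP: (lt x).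
apply: (graph_iso_of_parent (g := g)).
- exact: spider_graph_sym.
- exact: spider_graph_irr.
- move=> [x|] [y|] // E.
  + congr Some; have hE : tagged x = tagged y :> nat.
      by apply: (@addnI b); rewrite -!hg E.
    apply: spider_vertex_inj => //.
    have ls (a : {i : 'I_(size ks) & 'I_(nth 0 ks i)}) : tag a < size ws.
      by rewrite -sz ltn_ord.
    have lm (a : {i : 'I_(size ks) & 'I_(nth 0 ks i)}) :
        tag a < size [seq anc b w | w <- ws] by rewrite size_map.
    apply/eqP; rewrite -(nth_uniq (anc b c) (lm x) (lm y) U).
    by rewrite !(nth_map c) ?ls // -!/(W _) -!bg E.
  + by move: cb; rewrite -[c]/(g None) -E hg ltnNge leq_addr.
  + by move: cb; rewrite -[c]/(g None) E hg ltnNge leq_addr.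
- move=> x; case: (ltnP (h x) b) => [/lowc->|bx]; first by exists None.
  have [w wws [xw xE]] := surj x bx.
  have li : index w ws < size ks by rewrite sz index_mem.
  have Wi : W (index w ws) = w by rewrite /W nth_index.
  have lj : h x - b < nth 0 ks (index w ws) by rewrite kW // Wi; lia.
  have [a [ta tb]] := spider_vertex_at li lj.
  by exists (Some a); rewrite /g tb ta Wi subnKC.
- move=> [x|] [y|] //=.
  + case/andP=> /eqP txy /orP[]/eqP E; [right|left].
      rewrite parent_leg // -E addnS /= ifN; last by lia.
      by congr (anc _ (W _)); rewrite txy.
    rewrite parent_leg // -E addnS /= ifN; last by lia.
    by congr (anc _ (W _)); rewrite txy.
  + by move/eqP=> E; left; rewrite parent_leg // E addn0 eqxx.
  + by move/eqP=> E; right; rewrite parent_leg // E addn0 eqxx.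
- move=> [x|]; last by left.
  right; case: (posnP (tagged x)) => [x0|x0].
    by exists None; [rewrite /= x0 | rewrite /= parent_leg // x0 addn0 eqxx].
  have lj : (tagged x).-1 < nth 0 ks (tag x).
    by apply: leq_ltn_trans (leq_pred _) (ltn_ord _).
  have [a [ta tb]] := spider_vertex_at (ltn_ord (tag x)) lj.
  exists (Some a) => /=.
    by rewrite -val_eqE /= tb prednK // eqxx orbT ta eqxx.
  rewrite parent_leg // -[X in _ == X]addn0 eqn_add2l eqn0Ngt x0 /= tb ta.
  by rewrite -!subn1 addnBA.
Qed.

Section Broom.
Variables (u v q : T) (W : {set T}) (k : nat) (k0 : 0 < k).
Hypotheses (bd : b <= d) (ud : h u = d) (vd : h v = d).
Hypotheses (uv : anc b u != anc b v) (qu : anc b q != anc b u) (qv : anc b q != anc b v).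
Hypotheses (kE : k = (h q - b).+1) (bq : b <= h q).
Hypothesis WP : forall x, x \in W -> h x = (h q).+1 /\ p x = q.
Local Notation a := (d - b).+1.
Local Notation n := (2 * a).+1.
Local Notation broom := (spider_vertex (broom_legs k #|W|)).
Local Notation leg_vertex :=
  {i : 'I_(size (broom_legs k #|W|)) & 'I_(nth 0 (broom_legs k #|W|) i)}.

(** The handle of the broom is numbered from its centre, which goes to [q],
    towards its end, which goes to [c]. *)
Definition broom_map (y : broom) : T :=
  if y is Some x then
    if tag x == 0 :> nat then iter (tagged x).+1 p q else nth q (enum W) (tag x).-1
  else q.

Lemma broom_handle (x : leg_vertex) : tag x = 0 :> nat -> tagged x < k.
Proof. by move=> x0; have := ltn_ord (tagged x); rewrite {2}x0. Qed.

Lemma broom_bristle (x : leg_vertex) : tag x != 0 :> nat ->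
  [/\ tagged x = 0 :> nat, (tag x).-1 < #|W| & broom_map (Some x) \in W].
Proof.
move=> x0; have lt := ltn_ord (tagged x); have := ltn_ord (tag x).
rewrite [X in _ < X]/= size_nseq => lx.
have lW : (tag x).-1 < #|W| by move: x0 lx; case: (nat_of_ord (tag x)).
have nx : nth 0 (broom_legs k #|W|) (tag x) = 1.
  by move: x0 lW; case: (nat_of_ord (tag x)) => //= m _ lm; rewrite nth_nseq lm.
have := leq_trans lt (eq_leq nx); rewrite ltnS leqn0 => /eqP t0; split=> //.
by rewrite /= (negPf x0) -mem_enum mem_nth // -cardE.
Qed.

Lemma broom_map_handle (x : leg_vertex) : tag x = 0 :> nat ->
  broom_map (Some x) = iter (tagged x).+1 p q.
Proof. by rewrite /broom_map => /eqP->. Qed.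

Lemma broom_map_end : broom_map (broom_end #|W| k0) = c.
Proof. by rewrite /= -iterS prednK // kE iter_centre. Qed.

Lemma broom_map_edge (x y : broom) : spider_graph (broom_legs k #|W|) x y ->
  p (broom_map x) = broom_map y \/ p (broom_map y) = broom_map x.
Proof.
case: x y => [x|] [y|] //.
- case/andP=> /eqP txy; case: (eqVneq (tag x : nat) 0) => [x0|x0].
    have y0 : tag y = 0 :> nat by rewrite -txy.
    by rewrite !broom_map_handle // => /orP[]/eqP <-; [left|right].
  have y0 : tag y != 0 :> nat by rewrite -txy.
  by have [-> _ _] := broom_bristle x0; have [-> _ _] := broom_bristle y0.
- move=> /eqP x0; case: (eqVneq (tag x : nat) 0) => [t0|t0].
    by right; rewrite broom_map_handle // x0.
  by left; have [_ _ /WP[]] := broom_bristle t0.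
- move=> /eqP x0; case: (eqVneq (tag y : nat) 0) => [t0|t0].
    by left; rewrite broom_map_handle // x0.
  by right; have [_ _ /WP[]] := broom_bristle t0.
Qed.

Lemma broom_map_parent (y : broom) : y != broom_end #|W| k0 ->
  exists2 y' : broom, spider_graph (broom_legs k #|W|) y y'
    & p (broom_map y) = broom_map y'.
Proof.
case: y => [x|] neq; last first.
  have [x [x0 x1]] := @spider_vertex_at (broom_legs k #|W|) 0 0 isT k0.
  by exists (Some x); [rewrite /= x1 | rewrite broom_map_handle // x1].
case: (eqVneq (tag x : nat) 0) => [x0|x0]; last first.
  have [t0 _ xW] := broom_bristle x0.
  by exists None; [rewrite /= t0 | case: (WP xW)].
have lx := broom_handle x0; have neq' : tagged x != k.-1 :> nat.
  by apply: contraNneq neq => E; apply/eqP; congr Some; apply: spider_vertex_inj.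
have lx' : (tagged x).+1 < k by rewrite -ltn_predRL ltn_neqAle neq' -ltnS prednK.
have [y [y0 y1]] := @spider_vertex_at (broom_legs k #|W|) 0 _ isT lx'.
exists (Some y); last by rewrite !broom_map_handle // y1.
by rewrite /= y1 eqxx andbT -val_eqE /= y0; apply/eqP.
Qed.

Lemma broom_map_height (y : broom) : y != broom_end #|W| k0 ->
  [/\ b <= h (broom_map y), anc b (broom_map y) = anc b q &
   h (broom_map y) = if y is Some x then
     if tag x == 0 :> nat then h q - (tagged x).+1 else (h q).+1 else h q].
Proof.
case: y => [x|] neq //; case: (eqVneq (tag x : nat) 0) => [x0|x0]; last first.
  have [_ _ /WP[hx px]] := broom_bristle x0; rewrite hx.
  split=> //; first by lia.
  by rewrite -(@anc_parent _ _ _ _ _ _ R) ?px // hx; lia.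
have lx := broom_handle x0; have neq' : tagged x != k.-1 :> nat.
  by apply: contraNneq neq => E; apply/eqP; congr Some; apply: spider_vertex_inj.
have lx' : (tagged x).+1 < k by rewrite -ltn_predRL ltn_neqAle neq' -ltnS prednK.
rewrite broom_map_handle //; move: (nat_of_ord (tagged x)) lx' => t lt.
rewrite iter_anc //; last by lia.
by rewrite (height_anc R) ?(anc_anc R) //; [split=> //; lia|lia..].
Qed.

Lemma broom_map_inj (y y' : broom) : y != broom_end #|W| k0 -> y' != broom_end #|W| k0 ->
  broom_map y = broom_map y' -> y = y'.
Proof.
move=> /broom_map_height[_ _ hy] /broom_map_height[_ _ hy'] E; move: hy hy' E.
case: y y' => [x|] [x'|] //.
- case: (eqVneq (tag x : nat) 0) => x0; case: (eqVneq (tag x' : nat) 0) => x0' hy hy' E.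
  + congr Some; apply: spider_vertex_inj; first by rewrite x0 x0'.
    have := broom_handle x0; have := broom_handle x0'; move: hy'; rewrite -E hy.
    by move: (nat_of_ord (tagged x)) (nat_of_ord (tagged x')) => t t'; lia.
  + by move: hy'; rewrite -E hy; lia.
  + by move: hy'; rewrite -E hy; lia.
  have [t0 lx _] := broom_bristle x0; have [t0' lx' _] := broom_bristle x0'.
  congr Some; apply: spider_vertex_inj; last by rewrite t0 t0'.
  rewrite -(prednK (n := tag x)) ?lt0n // -(prednK (n := tag x')) ?lt0n //.
  congr S; apply/eqP; rewrite -(nth_uniq q _ _ (enum_uniq W)) -?cardE //.
  by move: E; rewrite /= (negPf x0) (negPf x0') => ->.
- by case: eqP => x0 hy hy' E; move: hy; rewrite E hy'; lia.
- by case: eqP => x0 hy hy' E; move: hy'; rewrite -E hy; lia.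
Qed.

(** The two legs carry the path; the broom hangs from [c], its handle leading
    to [q] and its bristles being [W]. *)
Lemma broom_iso :
  (forall x, b <= h x -> [\/ x = anc (h x) u \/ x = anc (h x) v,
     h x <= h q /\ x = anc (h x) q | x \in W]) ->
  graph_iso e (glue_graph (path_graph n) (spider_graph (broom_legs k #|W|))
                 (inord a) (broom_end #|W| k0)).
Proof.
move=> onto; pose pt := @legs u v n.
have nE : n = (2 * a).+1 /\ h (iter a p v) < b \/ n = 2 * a.
  by left; split=> //; have := @iter_centre v; rewrite vd => ->.
have join : iter a p u = iter (n.-1 - a) p v.
  have -> : n.-1 - a = a by lia.
  by have := @iter_centre v; have := @iter_centre u; rewrite vd ud => -> // ->.
have ptc : pt (inord a : 'I_n) = c.
  rewrite inordK; last by lia.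
  rewrite /pt /legs ltnn; have -> : n.-1 - a = a by lia.
  by have := @iter_centre v; rewrite vd => ->.
pose g (x : 'I_n + {y : broom | y != broom_end #|W| k0}) :=
  match x with inl i => pt i | inr y => broom_map (val y) end.
have leg_broom (i : 'I_n) (y : broom) : y != broom_end #|W| k0 -> pt i != broom_map y.
  move=> yP; have [by_ ay _] := broom_map_height yP.
  apply/eqP => E; rewrite -E in by_ ay.
  case: (ltnP i a) => [ia|ai].
    by have [_ bi] := legs_left bd ud vd uv nE ia; case/eqP: qu; rewrite -ay bi.
  case: (ltnP (n.-1 - i) a) => [ia|ai'].
    by have [_ bi] := legs_right bd ud vd uv nE ai ia; case/eqP: qv; rewrite -ay bi.
  have [_ lt] := legs_middle bd ud vd uv nE (ltn_ord i) ai ai'.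
  by rewrite /pt leqNgt lt in by_.
apply: (graph_iso_of_parent (g := g)).
- move=> [i|x] [j|y] /=; first exact: path_graph_sym.
  + by rewrite spider_graph_sym.
  + by rewrite spider_graph_sym.
  + exact: spider_graph_sym.
- by move=> [i|x] /=; [apply: path_graph_irr|apply: spider_graph_irr].
- move=> [i|x] [j|y] //= E.
  + by congr inl; apply/val_inj; apply: (legs_inj bd ud vd uv nE) E.
  + by case/eqP: (leg_broom i _ (valP y)).
  + by case/eqP: (leg_broom j _ (valP x)).
  + by congr inr; apply/val_inj/broom_map_inj; rewrite ?(valP x) ?(valP y).
- move=> x; case: (ltnP (h x) b) => [/lowc->|bx]; first by exists (inl (inord a)).
  have put (y : broom) : broom_map y = x -> exists m, g m = x.
    case: (eqVneq y (broom_end #|W| k0)) => [->|yP] yE; last first.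
      by exists (inr (exist _ y yP)).
    by exists (inl (inord a)); rewrite /= ptc -yE broom_map_end.
  case: (onto x bx) => [xuv|[xq xE]|xW].
  + have [i ltn <-] := legs_onto bd ud vd uv nE bx xuv.
    by exists (inl (Ordinal ltn)).
  + case: (eqVneq (h x) (h q)) => [E|neq].
      by apply: (put None); rewrite /= -[q](anc_id h p) -E.
    have lx : (h q - h x).-1 < k by lia.
    have [y [y0 y1]] := @spider_vertex_at (broom_legs k #|W|) 0 _ isT lx.
    apply: (put (Some y)); rewrite broom_map_handle // y1 prednK; last by lia.
    by rewrite -[iter _ _ _]/(anc (h x) q).
  + have lt : (index x (enum W)).+1 < size (broom_legs k #|W|).
      by rewrite /= size_nseq ltnS cardE index_mem mem_enum.
    have nt : 0 < nth 0 (broom_legs k #|W|) (index x (enum W)).+1.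
      by rewrite /= nth_nseq cardE index_mem mem_enum xW.
    have [y [y0 _]] := spider_vertex_at lt nt.
    apply: (put (Some y)); rewrite /broom_map ifN; last by rewrite y0.
    by rewrite y0 nth_index // mem_enum.
- move=> [i|x] [j|y] /=.
  + case/orP=> /eqP E; rewrite -E; [|apply/or_comm]; apply: (legs_edge bd ud vd uv nE join);
      rewrite E; exact: ltn_ord.
  + case/andP=> /eqP-> E; have := @broom_map_edge (broom_end #|W| k0) (val y) E.
    by rewrite broom_map_end ptc.
  + case/andP=> /eqP-> E; have := @broom_map_edge (val x) (broom_end #|W| k0) E.
    by rewrite broom_map_end ptc.
  + exact: (@broom_map_edge (val x) (val y)).
- move=> [i|x] /=.
    have root : p (legs u v n a) = legs u v n a.
      by have := ptc; rewrite /pt inordK => [->|]; [exact: pc|lia].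
    case: (legs_parent bd ud vd uv nE join i (or_introl root)) => [E|[j ij E]].
      by left.
    by right; exists (inl j).
  have [y xy pxy] := broom_map_parent (valP x).
  right; case: (eqVneq y (broom_end #|W| k0)) => [yE|yP].
    exists (inl (inord a)); first by rewrite yE in xy; rewrite /glue_graph eqxx.
    by rewrite /g pxy yE broom_map_end ptc.
  by exists (inr (exist _ y yP)).
Qed.

End Broom.

End OneCentre.
End Isomorphisms.

(** * Trees with two deepest vertices *)

Section Classification.
Variables (T : finType) (e : rel T) (h : T -> nat) (p : T -> T) (b d : nat).
Hypothesis R : rooting e h p b d.
Implicit Types (u v w x y z : T).
Local Notation anc := (anc h p).
Local Notation spine := (spine h p b d).
Local Notation level := (level h).

Lemma singleton_path (x0 : T) : d < b -> family_D e.
Proof.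
move=> db; have low x : h x < b by apply: leq_ltn_trans (rooting_le R x) db.
apply: (@family_D_path _ _ 1) => //.
have one x : x = x0 by apply: (low_unique R).
apply: (graph_iso_of_parent R (g := fun _ : 'I_1 => x0)).
- exact: path_graph_sym.
- exact: path_graph_irr.
- by move=> i j _; rewrite !ord1.
- by move=> x; exists ord0; rewrite (one x).
- by move=> i j _; left.
- by move=> i; left.
Qed.

Section TwoLegs.
Variables u v : T.
Hypotheses (bd : b <= d) (ud : h u = d) (vd : h v = d).
Hypothesis uv : anc b u != anc b v.
Hypothesis two : forall w, h w = d -> w = u \/ w = v.

Let spine_deep w i : h w = d -> b <= i <= d -> spine (anc i w).
Proof. exact: (spine_anc R). Qed.

Lemma two_legs_path : (forall x, b <= h x -> spine x) -> family_D e.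
Proof.
move=> all; have ends x : b <= h x -> x = anc (h x) u \/ x = anc (h x) v.
  by move=> bx; apply: (two_spine two) (all x bx).
have bb : b <= b <= h u by rewrite leqnn ud.
have bb' : b <= b <= h v by rewrite leqnn vd.
have hu : h (anc b u) = b by apply: (height_anc R).
have hv : h (anc b v) = b by apply: (height_anc R).
have aE w : h w = d -> iter (d - b) p w = anc b w by move=> <-.
case: (rooting_base R) => [[c [pc cb lowc topc]]|[c [c' [cc' pc pc' nolow base]]]].
  have center w : h w = d -> iter (d - b).+1 p w = c.
    by move=> wd; rewrite iterS aE // topc // (height_anc R) // wd leqnn.
  have nE : (2 * (d - b).+1).+1 = (2 * (d - b).+1).+1 /\
      h (iter (d - b).+1 p v) < b \/ (2 * (d - b).+1).+1 = 2 * (d - b).+1.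
    by left; rewrite center.
  have mid : (2 * (d - b).+1).+1.-1 - (d - b).+1 = (d - b).+1 by lia.
  have join : iter (d - b).+1 p u =
      iter ((2 * (d - b).+1).+1.-1 - (d - b).+1) p v by rewrite mid !center.
  have mE : legs p b d u v (2 * (d - b).+1).+1 (d - b).+1 = c.
    by rewrite /legs ltnn mid center.
  apply: (@family_D_path _ _ (2 * (d - b).+1).+1) => //.
  apply: (path_iso R bd ud vd uv nE join); first by left; rewrite mE pc.
  move=> x; case: (ltnP (h x) b) => [/lowc->|bx].
    by exists (d - b).+1; [lia|].
  exact: (legs_onto R bd ud vd uv nE bx (ends x bx)).
have swap : p (anc b u) = anc b v /\ p (anc b v) = anc b u.
  by move: uv; case: (base _ hu) => ->; case: (base _ hv) => ->; rewrite ?eqxx.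
have nE : 2 * (d - b).+1 = (2 * (d - b).+1).+1 /\
    h (iter (d - b).+1 p v) < b \/ 2 * (d - b).+1 = 2 * (d - b).+1 by right.
have mid : (2 * (d - b).+1).-1 - (d - b).+1 = d - b by lia.
have join : iter (d - b).+1 p u =
    iter ((2 * (d - b).+1).-1 - (d - b).+1) p v.
  by rewrite mid iterS !aE //; case: swap.
apply: (@family_D_path _ _ (2 * (d - b).+1)); first by lia.
apply: (path_iso R bd ud vd uv nE join).
  right; rewrite /legs ltnn mid aE //= ltnSn aE //; by case: swap.
move=> x; apply: (legs_onto R bd ud vd uv nE) => //; exact: ends.
Qed.

Definition off_spine x := (b <= h x) && ~~ spine x.

(** If an off-spine vertex is attached to a leg, or if two off-spine vertices of
    one level are not leaves with the same parent, then a suitable rigid set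
    exists. Otherwise all off-spine vertices hang from a single centre, and at
    most one level has several of them, which are sibling leaves, and the others
    form a path: the tree is a path, a spider, or a path with a broom. *)
Lemma two_legs : (exists2 O, large h d O & rigid h p O) \/ family_D e \/
  (family_F e /\ exists x y, [/\ off_spine x, off_spine y, h y = h x & x != y]).
Proof.
case: (boolP [exists x, ~~ spine x && spine (p x)]) => [/existsP[x /andP[sx spx]]|].
  by left; apply: (rigid_of_attached R bd ud vd uv two sx spx).
move=> /existsPn no_att.
have off_parent x : ~~ spine x -> ~~ spine (p x).
  by move=> sx; have := no_att x; rewrite sx.
have off_anc x i : off_spine x -> b <= i <= h x -> off_spine (anc i x).
  case/andP=> bx sx bix; rewrite /off_spine (height_anc R) //; apply/andP; split.
    by case/andP: bix.
  by rewrite /anc; elim: (h x - i) => //= m; apply: off_parent.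
case: (boolP [exists x, off_spine x]) => [/existsP[x0 off0]|]; last first.
  move=> /existsPn none; right; left; apply: two_legs_path => x bx.
  by have := none x; rewrite /off_spine bx negbK.
have bx0 : b <= h x0 by case/andP: off0.
(* With two centres, the ancestor of [x0] of height [b] would be a centre, and
   thus on the spine. *)
case: (rooting_base R) => [|[c [c' [_ _ _ nolow _]]]]; last first.
  have bb : b <= b <= h x0 by rewrite leqnn.
  have /andP[bA sA] := off_anc _ _ off0 bb.
  have := nonspine_parent R bd ud vd uv sA bA.
  by rewrite (height_anc R) // ltnNge nolow.
case=> c [pc cb lowc topc].
have off_lt x : off_spine x -> h x < d.
  by case/andP=> _; apply: (nonspine_lt R bd).
have off_neq x w : off_spine x -> h w = d -> anc b x != anc b w.
  move=> offx wd; have bb : b <= b <= h x by rewrite leqnn; case/andP: offx.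
  have /andP[_] := off_anc _ _ offx bb; apply: contraNneq => ->.
  by apply: spine_deep; rewrite // leqnn.
case: (boolP [exists x, exists y, [&& off_spine x, off_spine y, h y == h x & x != y]]).
  case/existsP=> x /existsP[y /and4P[offx offy /eqP yx neq]].
  case: (boolP [exists x, exists y, [&& off_spine x, off_spine y, h y == h x, x != y &
      (p x != p y) || [exists z, (b < h z) && ((p z == x) || (p z == y))]]]).
    case/existsP=> x' /existsP[y' /and5P[offx' offy' /eqP yx' neq' sep]]; left.
    case/andP: offx' => bx' sx'; case/andP: offy' => _ sy'.
    apply: (rigid_of_pair R bd ud vd uv two sx' sy' bx' yx' neq').
    case/orP: sep => [|/existsP[z /andP[bz /orP[]/eqP pz]]]; first by left.
      by right; exists z; split=> //; left.
    by right; exists z; split=> //; right.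
  move=> /existsPn nosep.
  have sib x' y' : off_spine x' -> off_spine y' -> h y' = h x' -> x' != y' ->
      p x' = p y' /\ forall z, b < h z -> p z != x'.
    move=> ox oy hxy nxy; have /existsPn/(_ y') := nosep x'.
    rewrite ox oy hxy eqxx nxy /= negb_or negbK => /andP[/eqP-> /existsPn noz].
    by split=> // z bz; have := noz z; rewrite bz /= negb_or => /andP[].
  right; right; split; last by exists x, y.
  have leaf x' : off_spine x' -> h x' = h x -> forall z, b < h z -> p z != x'.
    move=> ox hx'; case: (eqVneq x' x) => [->|nx].
      by case: (sib x y).
    by case: (sib x' x).
  pose q := p x; pose W := [set z | off_spine z && (h z == h x)].
  have Wp z : z \in W -> p z = q.
    rewrite inE => /andP[oz /eqP hz]; case: (eqVneq z x) => [->//|nz].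
    by case: (sib z x oz offx _ nz).
  have xW : x \in W by rewrite inE offx eqxx.
  have W0 : 0 < #|W| by apply/card_gt0P; exists x.
  have child z i : off_spine z -> b <= i < h z -> b < h (anc i.+1 z) /\
      p (anc i.+1 z) = anc i z.
    move=> oz biz; rewrite (@parent_anc _ h p b) //.
    by rewrite (height_anc R); [split=> //|]; lia.
  have le_x z : off_spine z -> h z <= h x.
    move=> oz; rewrite leqNgt; apply/negP => lt; have bx : b <= h x by case/andP: offx.
    have [bz pz] := child z (h x) oz (introT andP (conj bx lt)).
    have := leaf (anc (h x) z) _ _ _ bz; rewrite pz eqxx.
    have bxz : b <= h x <= h z by rewrite bx ltnW.
    by rewrite (height_anc R) // => /(_ (off_anc _ _ oz bxz) erefl).
  have lt_x z : off_spine z -> h z < h x -> z = anc (h z) x.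
    move=> oz lt; apply/eqP/negPn/negP => neqz; have bz : b <= h z by case/andP: oz.
    have bzx : b <= h z <= h x by rewrite bz ltnW.
    have [_ noz] := sib (anc (h z) x) z (off_anc _ _ offx bzx) oz
      (esym (height_anc R bzx)) (contra_neq esym neqz).
    have [bz' pz'] := child x (h z) offx (introT andP (conj bz lt)).
    by have := noz _ bz'; rewrite pz' eqxx.
  have onto z : b <= h z -> [\/ z = anc (h z) u \/ z = anc (h z) v,
      off_spine z /\ h z < h x | z \in W].
    move=> bz; case sz: (spine z).
      by apply: Or31; apply: (two_spine two sz).
    have oz : off_spine z by rewrite /off_spine bz sz.
    case: (ltnP (h z) (h x)) => [lt|ge]; first by apply: Or32.
    by apply: Or33; rewrite inE oz eqn_leq le_x.
  have bx : b <= h x by case/andP: offx.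
  have xd := off_lt x offx.
  (* The several off-spine vertices are bristles at the end of a handle, or
     neighbours of the centre. *)
  case: (ltnP b (h x)) => [bx'|xb].
    have hq : h q = (h x).-1 by rewrite (rooting_parent R).
    have aq i : b <= i < h x -> anc i q = anc i x by move=> bix; apply: (anc_parent R).
    have bxx : b <= b < h x by rewrite leqnn.
    clearbody q.
    have k0 : 0 < (h q - b).+1 by [].
    apply: (@family_F_broom _ _ (d - b).+1 (h q - b).+1 #|W| k0) => //; first by lia.
    have qw w : h w = d -> anc b q != anc b w by move=> wd; rewrite aq // off_neq.
    have bq : b <= h q by lia.
    apply: (broom_iso R pc cb lowc topc k0 bd ud vd uv (qw u ud) (qw v vd) erefl bq).
    - move=> z zW; rewrite Wp //; split=> //.
      by move: zW; rewrite inE => /andP[_ /eqP->]; lia.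
    move=> z bz; case: (onto z bz) => [zuv|[oz lt]|zW];
      [exact: Or31|apply: Or32|exact: Or33].
    by rewrite aq ?bz // -lt_x //; split=> //; lia.
  have hx : h x = b by apply/eqP; rewrite eqn_leq xb.
  have hW w : w \in W -> h w = b by rewrite inE hx => /andP[_ /eqP].
  apply: (@family_F_spider _ _ (d - b).+1 #|W|) => //.
  have -> : [:: (d - b).+1, (d - b).+1 & nseq #|W| 1] =
      [seq (h w - b).+1 | w <- [:: u, v & enum W]].
    rewrite /= ud vd cardE; congr [:: _, _ & _].
    have: {subset enum W <= W} by move=> w; rewrite mem_enum.
    elim: (enum W) => //= w s IHs sub.
    rewrite hW ?sub ?mem_head // subnn IHs // => w' w's.
    by rewrite sub // in_cons w's orbT.
  apply: (spider_iso R pc cb lowc topc).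
  - rewrite /= ud vd bd; apply/allP => w; rewrite mem_enum => /hW->; exact: leqnn.
  - have mapW : [seq anc b w | w <- enum W] = enum W.
      rewrite -[RHS]map_id; apply/eq_in_map => w.
      by rewrite mem_enum => /hW hw; rewrite -{1}hw anc_id.
    have neqW w : h w = d -> anc b w \notin enum W.
      move=> wd; rewrite mem_enum inE /off_spine negb_and; apply/orP; left.
      by rewrite negb_and negbK spine_deep ?leqnn ?orbT.
    by rewrite /= mapW inE negb_or uv !neqW // enum_uniq.
  move=> z bz; case: (onto z bz) => [[] zE|[oz lt]|zW].
  - by exists u; rewrite ?inE ?eqxx // ud (rooting_le R).
  - by exists v; rewrite ?inE ?eqxx ?orbT // vd (rooting_le R).
  - by rewrite hx ltnNge bz in lt.
  - exists z; first by rewrite !inE mem_enum zW !orbT.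
    by rewrite anc_id.
move=> /existsPn nopair.
have single x y : off_spine x -> off_spine y -> h y = h x -> x = y.
  move=> ox oy hxy; apply/eqP; have /existsPn/(_ y) := nopair x.
  by rewrite ox oy hxy eqxx /= negbK.
(* No level has two off-spine vertices, so they form the leg that ends in [w]. *)
pose w := [arg max_(x > x0 | off_spine x) h x].
have [ow maxw] : off_spine w /\ forall x, off_spine x -> h x <= h w.
  by rewrite /w; case: arg_maxnP.
have bw : b <= h w by case/andP: ow.
have wd := off_lt w ow.
right; left; apply: (@family_D_spider _ _ (d - b).+1 (h w - b).+1) => //; first by lia.
have -> : [:: (d - b).+1; (d - b).+1; (h w - b).+1] =
    [seq (h w - b).+1 | w <- [:: u; v; w]] by rewrite /= ud vd.
apply: (spider_iso R pc cb lowc topc).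
- by rewrite /= ud vd bd bw.
- by rewrite /= !inE negb_or uv eq_sym off_neq // eq_sym off_neq.
move=> z bz; case sz: (spine z).
  case: (two_spine two sz) => zE.
    by exists u; rewrite ?inE ?eqxx // ud (rooting_le R).
  by exists v; rewrite ?inE ?eqxx ?orbT // vd (rooting_le R).
have oz : off_spine z by rewrite /off_spine bz sz.
have bzw : b <= h z <= h w by rewrite bz maxw.
exists w; first by rewrite !inE eqxx !orbT.
split; first exact: maxw.
by apply: single; rewrite ?(height_anc R) //; apply: off_anc.
Qed.

End TwoLegs.
End Classification.

(** * Classification and the two bounds *)

Section Main.
Variables (T : finType) (e : rel T) (h : T -> nat) (p : T -> T) (b d : nat).
Hypothesis R : rooting e h p b d.
Implicit Types (u v w x y z : T).
Local Notation anc := (anc h p).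
Local Notation level := (level h).

(** Three branches cannot start from two vertices. *)
Lemma deep_injective_one_centre u v w : h u = d -> h v = d -> h w = d -> b <= d ->
  uniq [seq anc b x | x <- [:: u; v; w]] ->
  exists c, [/\ p c = c, h c < b, forall x, h x < b -> x = c
    & forall x, h x = b -> p x = c].
Proof.
move=> ud vd wd bd; case: (rooting_base R) => // -[c [c' [_ _ _ _ base]]].
have ha x : h x = d -> anc b x = c \/ anc b x = c'.
  by move=> xd; apply: base; rewrite (height_anc R) // xd leqnn.
rewrite /= !inE negb_or; case: (ha u ud) => ->; case: (ha v vd) => ->;
  case: (ha w wd) => ->; rewrite ?eqxx ?andbF //.
Qed.

(** If some level other than the deepest one has a fourth vertex, then the
    ancestor of [u] in this level can be kept fixed, which excludes the exchange
    of [u] and [v]. If none has, then the tree is a star, or else it consists of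
    three equal legs, that is, of a path and a broom with a single bristle. *)
Lemma three_deep u v w : h u = d -> h v = d -> h w = d -> b <= d ->
  uniq [seq anc b x | x <- [:: u; v; w]] ->
  (forall x y, h x = d -> h y = d -> anc b x = anc b y -> x = y) ->
  (exists2 O, large h d O & rigid h p O) \/ family_D e \/
  (family_F e /\ forall k, #|level d| <= k.+1 -> colourable h p k).
Proof.
move=> ud vd wd bd U inj.
have [c [pc cb lowc topc]] := deep_injective_one_centre ud vd wd bd U.
have := U; rewrite /= !inE negb_or => /and3P[/andP[uv uw] vw _].
have neq x y : anc b x != anc b y -> x != y by apply: contraNneq => ->.
move: bd; rewrite leq_eqVlt => /predU1P[bE|bd].
  have allb x : b <= h x -> h x = b.
    by move=> bx; apply/eqP; rewrite eqn_leq bx andbT bE (rooting_le R).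
  right; left; apply: family_D_star (star_iso R pc cb lowc topc allb).
  by apply/card_gt0P; exists u; rewrite inE ud bE.
case: (boolP [exists i : 'I_d, (b <= i) && (3 < #|level i|)]).
  case/existsP=> i /andP[bi i3].
  have lid := ltn_ord i; have biu : b <= i <= h u by rewrite bi ud ltnW.
  left; apply: (rigid_of_asymmetric_triple R
    (u := u) (v := v) (w := w) (z := anc i u)) => //.
  - exact: ltnW.
  - by rewrite eq_sym.
  - by rewrite (anc_anc R) ?leqnn //; case/andP: biu.
  - by apply/eqP => E; move: lid; rewrite -(height_anc R biu) E ud ltnn.
  - by rewrite (height_anc R).
  - by rewrite (height_anc R biu) eq_sym.
move=> /existsPn small; right; right.
have le3 i : b <= i < d -> #|level i| <= 3.
  case/andP=> bi id; have := small (Ordinal id).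
  by rewrite /= bi /= -leqNgt.
have mid i x : b <= i < d -> h x = i -> [\/ x = anc i u, x = anc i v | x = anc i w].
  case/andP=> bi id hx; have bid : b <= b <= i by rewrite leqnn.
  have ha y : h y = d -> h (anc i y) = i by move=> yd; rewrite (height_anc R) // yd bi ltnW.
  have ne y z : h y = d -> h z = d -> anc b y != anc b z -> anc i y != anc i z.
    by move=> yd zd; apply: (anc_neq R bid); rewrite ?yd ?zd ltnW.
  pose A := [:: anc i u; anc i v; anc i w].
  have UA : uniq A.
    by rewrite /= !inE negb_or (ne u v) // (ne u w) // (ne v w).
  have AE : [set y in A] = level i.
    apply/eqP; rewrite eqEcard; apply/andP; split.
      by apply/subsetP => y; rewrite !inE => /or3P[]/eqP->; rewrite ha.
    apply: leq_trans (le3 i _) _; first by rewrite bi.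
    rewrite -[3]/(size A) -(card_uniqP UA); apply/subset_leq_card/subsetP => y.
    by rewrite inE.
  have : x \in [set y in A] by rewrite AE inE hx.
  by rewrite !inE => /or3P[]/eqP->; [apply: Or31|apply: Or32|apply: Or33].
have bb : b <= b < d by rewrite leqnn.
have deep x : h x = d -> [\/ x = u, x = v | x = w].
  move=> xd; have hx : h (anc b x) = b by rewrite (height_anc R) // xd leqnn ltnW.
  by case: (mid b _ bb hx) => /inj->; rewrite //; [apply: Or31|apply: Or32|apply: Or33].
have aE x : h x = d -> anc d x = x by move=> <-; apply: anc_id.
have all x : b <= h x -> [\/ x = anc (h x) u, x = anc (h x) v | x = anc (h x) w].
  move=> bx; case: (ltnP (h x) d) => [xd|dx]; first by apply: mid; rewrite ?bx.
  have xd : h x = d by apply/eqP; rewrite eqn_leq dx (rooting_le R).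
  by rewrite xd !aE //; apply: deep.
have bdw : b < h w by rewrite wd.
have hq : h (p w) = d.-1 by rewrite (rooting_parent R) // wd.
have aq i : b <= i < d -> anc i (p w) = anc i w.
  by move=> bid; apply: (anc_parent R); rewrite wd.
split; last first.
  by move=> k; apply: (three_legs_colourable R bd ud vd wd).
have k0 : 0 < (h (p w) - b).+1 by [].
apply: (@family_F_broom _ _ (d - b).+1 (h (p w) - b).+1 #|[set w]| k0) => //.
- by rewrite cards1.
- by rewrite hq; lia.
have wu : anc b (p w) != anc b u by rewrite aq // eq_sym.
have wv : anc b (p w) != anc b v by rewrite aq // eq_sym.
have bq : b <= h (p w) by rewrite hq; lia.
apply: (broom_iso R pc cb lowc topc k0 (ltnW bd) ud vd uv wu wv erefl bq).
  by move=> x; rewrite inE => /eqP->; split=> //; rewrite hq wd; lia.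
move=> x bx; case: (all x bx) => xE; [by apply: Or31; left|by apply: Or31; right|].
case: (ltnP (h x) d) => [xd|dx].
  by apply: Or32; rewrite aq ?bx // hq; split=> //; lia.
have xd : h x = d by apply/eqP; rewrite eqn_leq dx (rooting_le R).
by apply: Or33; rewrite inE xE xd aE.
Qed.

(** Any two deepest vertices [x] and [y] with a common ancestor of height [b],
    and a third one elsewhere, satisfy [rigid_of_asymmetric_triple] with [y]
    kept fixed. It remains to treat deepest vertices in distinct branches,
    according to whether there are more than two of them. *)
Lemma classification (x0 : T) :
  (exists2 O, large h d O & rigid h p O) \/ family_D e \/
  (family_F e /\ forall k, #|level d| <= k.+1 ->
     (forall i, i < d -> #|level i| <= k.+2) -> colourable h p k).
Proof.
case: (ltnP d b) => [db|bd]; first by right; left; apply: (singleton_path R x0 db).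
have [u [v [ud vd uv]]] := rooting_deep R bd.
case: (boolP [exists x, exists y,
    [&& h x == d, h y == d, anc b x == anc b y & x != y]]).
  case/existsP=> x /existsP[y /and4P[/eqP xd /eqP yd /eqP xy neq]]; left.
  have [v' [vd' xv']] : exists v', h v' = d /\ anc b x != anc b v'.
    case: (eqVneq (anc b u) (anc b x)) => [<-|ux]; first by exists v.
    by exists u; rewrite eq_sym.
  apply: (rigid_of_asymmetric_triple R (u := x) (v := v') (w := x) (z := y)) => //.
  - by rewrite eq_sym.
  - by rewrite yd.
  - by rewrite yd ltnn.
move=> /existsPn noeq.
have inj x y : h x = d -> h y = d -> anc b x = anc b y -> x = y.
  move=> xd yd xy; apply/eqP; have /existsPn/(_ y) := noeq x.
  by rewrite xd yd xy !eqxx /= negbK.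
case: (boolP [exists w, [&& h w == d, w != u & w != v]]).
  case/existsP=> w /and3P[/eqP wd wu wv].
  have U : uniq [seq anc b x | x <- [:: u; v; w]].
    rewrite /= !inE negb_or uv /= andbT ![_ == anc b w]eq_sym.
    by apply/andP; split; [apply: contraNneq wu|apply: contraNneq wv] => /inj->.
  case: (three_deep ud vd wd bd U inj) => [|[|[fF col]]]; [by left|by right; left|].
  by right; right; split=> // k kd _; apply: col.
move=> /existsPn now.
have two w : h w = d -> w = u \/ w = v.
  move=> wd; have := now w; rewrite wd eqxx /= negb_and !negbK.
  by case/orP=> /eqP; [left|right].
case: (two_legs R bd ud vd uv two) => [|[|[fF [x [y [/andP[bx sx] /andP[_ sy] yx neq]]]]]].
- by left.
- by right; left.
right; right; split=> // k _ ki.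
exact: (colourable_of_pair R bd ud vd uv two sx sy bx yx neq ki).
Qed.

End Main.

Lemma card_levels (T : finType) (h : T -> nat) (r d : nat) (A : {set T}) :
  (forall x, r <= h x <= d) -> #|A| = \sum_(r <= i < d.+1) #|A :&: level h i|.
Proof.
move=> hr; have lvl i : #|A :&: level h i| = \sum_(x in A) (h x == i).
  rewrite -sum1_card big_mkcond [RHS]big_mkcond; apply: eq_bigr => x _ /=.
  by rewrite !inE; case: (x \in A) => //=; case: eqP.
under eq_bigr do rewrite lvl.
rewrite exchange_big /= -sum1_card; apply: eq_bigr => x _.
rewrite (bigD1_seq (h x)) ?iota_uniq ?mem_index_iota ?ltnS //= eqxx big1 //.
by move=> i /negPf neq; rewrite eq_sym neq.
Qed.

Lemma large_complement (T : finType) (h : T -> nat) (r d : nat) (O : {set T}) :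
  (forall x, r <= h x <= d) -> r <= d -> large h d O ->
  #|~: O| <= (#|level h d| - 2) + \sum_(r <= i < d) (#|level h i| - 3).
Proof.
move=> hr rd [lO lO']; rewrite (card_levels (~: O) hr) big_nat_recr //= addnC.
have compl i : #|~: O :&: level h i| = #|level h i| - #|O :&: level h i|.
  by rewrite setIC -setDE cardsD [level h i :&: O]setIC.
apply: leq_add; first by rewrite compl leq_sub2l.
rewrite !big_nat; apply: leq_sum => i /andP[_ id].
by rewrite compl; have := lO' i id; lia.
Qed.

Import Order.TTheory GRing.Theory Num.Theory.
Local Open Scope ring_scope.

Theorem theorem13 (T : finType) (e : rel T) (d r : nat) (m : nat -> int)
    (treeT : tree e) (dE : d = diameter e) (rE : r = radius e)
    (mE : forall i : nat, (r <= i <= d)%N -> m i = (ecc_count e i)%:Z) :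
  (~ family_D e ->
     (distinguishing_number e)%:Z <=
       \big[Num.max/m d - 1]_(r <= i < d) (m i - 2)) /\
  (~ family_F e ->
     (fixing_number e)%:Z <=
       m d - 2 + \sum_(r <= i < d) Num.max (m i - 3) 0).
Proof.
have [c cE min_c] := centre_exists treeT.
have [b [R rb]] := tree_rooting treeT.
have hr x : (r <= eccentricity e x <= d)%N.
  by rewrite rE dE min_c ecc_le_diameter.
have rd : (r <= d)%N by case/andP: (hr c) => /leq_trans; apply.
rewrite -dE in R.
have md : m d = #|level (eccentricity e) d|%:Z by rewrite mE // rd leqnn.
have mi i : (r <= i < d)%N -> m i = #|level (eccentricity e) i|%:Z.
  by case/andP=> ri id; rewrite mE // ri ltnW.
have low i : (i < r)%N -> #|level (eccentricity e) i| = 0%N.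
  move=> ir; apply: eq_card0 => x; rewrite inE; apply/negbTE.
  by apply: contraTneq ir => <-; rewrite -leqNgt; case/andP: (hr x).
have cls := classification R c.
split=> [notD|notF]; last first.
  have [O lO rO] : exists2 O, large (eccentricity e) d O
      & rigid (eccentricity e) (parent e) O.
    by case: cls => [//|[fD|[fF _]]]; [case: notF; apply: family_F_D|].
  have le_F : (fixing_number e <= (#|level (eccentricity e) d| - 2) +
      \sum_(r <= i < d) (#|level (eccentricity e) i| - 3))%N.
    exact: leq_trans (rigid_fixing R rO) (large_complement hr rd lO).
  have d2 : (2 <= #|level (eccentricity e) d|)%N.
    by case: lO => lO _; apply: leq_trans lO _; rewrite subset_leq_card ?subsetIr.
  have sumE : \sum_(r <= i < d) Num.max (m i - 3) 0 =
      (\sum_(r <= i < d) (#|level (eccentricity e) i| - 3))%N%:Z.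
    rewrite (big_morph Posz PoszD (erefl _)) !big_nat; apply: eq_bigr => i rid.
    by rewrite mi //; lia.
  by rewrite sumE md; lia.
set K := \big[_/_]_(_ <= _ < _) _.
have Kd : m d - 1 <= K by apply: bigmax_ge_id.
have Ki i : (r <= i < d)%N -> m i - 2 <= K.
  move=> rid; apply: (@le_bigmax_seq _ _ _ _ _ i); rewrite ?mem_index_iota //.
have [u ud] := diameter_attained treeT.
have d1 : (0 < #|level (eccentricity e) d|)%N.
  by apply/card_gt0P; exists u; rewrite inE ud dE.
have K0 : 0 <= K by apply: le_trans Kd; rewrite md; lia.
rewrite -(gez0_abs K0) lez_nat; set k := `|K|%N.
have KE : K = k%:Z by rewrite gez0_abs.
clearbody k; rewrite KE in Kd Ki.
have kd : (#|level (eccentricity e) d| <= k.+1)%N by move: Kd; rewrite md; lia.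
have ki i : (i < d)%N -> (#|level (eccentricity e) i| <= k.+2)%N.
  move=> id; case: (ltnP i r) => [/low->//|ri].
  by have := Ki i; rewrite mi ri id // => /(_ isT); lia.
apply: (colourable_distinguishing R).
case: cls => [[O lO rO]|[//|[_ col]]]; last exact: col.
exact: (rigid_colourable R lO rO kd ki).
Qed.
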